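(* Let $p>3$ be a prime. Then $$\sum_{k=0}^{p-1}\frac{\binom{2k}{k}\binom{3k}{k}}{(k+1)24^k}\equiv\frac12\binom{2\left(p-\left(\frac{p}{3}\right)\right)/3}{\left(p-\left(\frac{p}{3}\right)\right)/3}\pmod p.$$ Moreover, when $p\equiv 1\pmod 3$ and $4p=x^2+27y^2$ with $x,y\in\mathbb{Z}$ and $x\equiv 2\pmod 3$, we have $$\sum_{k=0}^{p-1}\frac{k+2}{24^k}\binom{2k}{k}\binom{3k}{k}\equiv x\pmod{p^2}.$$
   Context: $\left(\frac{p}{3}\right)$ denotes the Legendre symbol, i.e. it equals $1$ if $p\equiv 1\pmod 3$ and $-1$ if $p\equiv 2\pmod 3$. Congruences modulo $p$ or $p^2$ between rational numbers whose denominators (in lowest terms) are prime to $p$ are understood in the ring $\mathbb{Z}_p$ of $p$-adic integers (equivalently, in the localization $\mathbb{Z}_{(p)}$); each term $\binom{2k}{k}\binom{3k}{k}/((k+1)24^k)$ is $p$-integral since $\binom{2k}{k}/(k+1)$ is an integer. *)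

(* Defs.v *)
From mathcomp Require Import all_boot all_order all_algebra.

Set Implicit Arguments.
Unset Strict Implicit.
Unset Printing Implicit Defensive.

Import Order.TTheory GRing.Theory Num.Theory.
Local Open Scope ring_scope.

(* The Legendre symbol (p / 3). *)
Definition legendre3 (p : nat) : int :=
  if (p %% 3 == 1)%N then 1 else if (p %% 3 == 2)%N then - 1 else 0.

(* The localization Z_(p), for p prime; [denq a] is in lowest terms. *)
Definition in_Zloc (p : nat) (a : rat) : bool := coprime p `|denq a|%N.

(* Congruence modulo p ^ m in the ring Z_(p): it includes the requirement
   that both sides be p-integral. *)
Definition eqmod_Zloc (p m : nat) (a b : rat) : Prop :=
  [/\ in_Zloc p a, in_Zloc p b
    & exists2 c : rat, in_Zloc p c & a - b = (p ^ m)%N%:R * c].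

(* Main.v *)
(* The term of the sum is deformed with a parameter s, which gives
   f(s) = 2F1((1-s)/3, (2-s)/3; 1-s; 9/8). For s a natural number prime to 3
   the series f(s) terminates, and so does the companion
   h(s) = sum_k (k+1+s) t(s,k); both satisfy a first-order recurrence
   s -> s+3, hence are explicit products. Modulo p^2 the truncated sums are
   affine in s for s in pZ, so their values at s = 0 are 2f(p) - f(2p) and
   2h(p) - h(2p). For p = 1 (mod 3) and C = binomial(2(p-1)/3, (p-1)/3), the
   products evaluate to f(0) = C and h(0) = p/C, and the second sum is
   f(0) + h(0) = C + p/C. The first sum is (f(0) - h(0))/2 modulo p, by a
   telescoping identity.

   It remains to see that x = C + p/C modulo p^2. With the Teichmueller lift
   tau: F_p -> Z/p^2 and the cubic character tau^((p-1)/3), the two conjugate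
   Jacobi sums U, V in Z/p^2 satisfy UV = p, and expanding
   U = sum_t tau(t)^(2(p-1)/3) tau(1-t)^(2(p-1)/3) gives U = -C. Grouping by
   cubic classes, U + V is an integer X with 4p = X^2 + 27Z^2 and
   X = 1 (mod 3), so x = -X by uniqueness of that representation. *)

(* At s = 0 the series does not terminate, so a recurrence in s says nothing about its truncation.
   The points p and 2 p are the multiples of p below 3 p; both are prime to 3, so there f and h stop
   before index p and are products. With s = m p, the values at m = 1 and m = 2 determine an affine
   function of m; modulo p one of them is enough.

   [ModSquare] works in an abstract ring R where naturals prime to p are invertible and a natural
   vanishes exactly when p^2 divides it. Congruence modulo p is expressed there as equality after
   multiplication by P, since P a = 0 exactly when p divides a.

   No complex absolute value is used for the Jacobi sums: UV is the image of an integral norm that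
   is congruent to p modulo p^2 and lies between 0 and (p - 2)^2, so this norm equals p. Only U is
   expanded; it is a unit, and V = p / U follows. *)
Require Import Defs.
From mathcomp Require Import all_boot all_order all_algebra.
From mathcomp Require Import ring lra zify.

Import Order.TTheory GRing.Theory Num.Theory.
Local Open Scope ring_scope.

Set Implicit Arguments.
Unset Strict Implicit.
Unset Printing Implicit Defensive.

(** * The deformed hypergeometric sums *)

(* [hterm 0 k] is the summand binom(2k,k) binom(3k,k) / 24^k. At a natural s
   the factor i = s - 1 has a zero denominator, hence is 0; by then the series
   has already terminated (3 i + 1 = s or 3 i + 2 = s). *)
Definition hterm (s : rat) (k : nat) : rat :=
  \prod_(0 <= i < k)
    (((3 * i)%:R + 1 - s) * ((3 * i)%:R + 2%:R - s) /
       (8%:R * i.+1%:R * (i.+1%:R - s))).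

Lemma hterm0 s : hterm s 0 = 1.
Proof. by rewrite /hterm big_nil. Qed.

Lemma htermS s k : hterm s k.+1 =
  hterm s k * (((3 * k)%:R + 1 - s) * ((3 * k)%:R + 2%:R - s) /
       (8%:R * k.+1%:R * (k.+1%:R - s))).
Proof. by rewrite /hterm big_nat_recr. Qed.

Lemma hterm_eq0 (s i k : nat) : (s == 3 * i + 1)%N || (s == 3 * i + 2)%N ->
  (i < k)%N -> hterm s%:R k = 0.
Proof.
move=> s3 ik; rewrite /hterm (bigD1_seq i) ?iota_uniq ?mem_index_iota //=.
suff -> : ((3 * i)%:R + 1 - s%:R) * ((3 * i)%:R + 2%:R - s%:R) = 0 :> rat.
  by rewrite !mul0r.
by case/orP: s3 => /eqP ->; ring.
Qed.

(** Raising s by 3 turns the numerator factor of index i into the one of index i - 1, and the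
    factors i + 1 - s telescope; k < s keeps them nonzero. This lets both certificates be checked in
    terms of [hterm s K] alone. *)
Lemma hterm_shift (s k : nat) : (k < s)%N ->
  hterm (s%:R + 3%:R) k.+1 =
  - ((s%:R - k%:R) * (s%:R + 1 - k%:R)) / (8%:R * s%:R * k.+1%:R)
    * hterm s%:R k.
Proof.
elim: k => [|k IHk] ks.
  rewrite htermS !hterm0.
  have s0 : s%:R != 0 :> rat by rewrite pnatr_eq0; lia.
  have s2 : s%:R + 2%:R != 0 :> rat by rewrite -natrD pnatr_eq0; lia.
  by field; rewrite ?s0 ?s2 /= -?opprD ?oppr_eq0; apply/eqP; lra.
rewrite htermS IHk 1?ltnW // htermS.
have k1 : k%:R + 1 != 0 :> rat by rewrite natr1 pnatr_eq0.
have k2 : k%:R + 2%:R != 0 :> rat by rewrite -natrD pnatr_eq0; lia.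
have d1 : k%:R + 1 - s%:R != 0 :> rat by rewrite natr1 subr_eq0 eqr_nat; lia.
have d2 : k%:R - s%:R - 1 != 0 :> rat.
  by rewrite -addrA -opprD natr1 subr_eq0 eqr_nat; lia.
have s0 : s%:R != 0 :> rat by rewrite pnatr_eq0; lia.
rewrite !natrM -(natr1 k.+1) -!(natr1 k).
move: (hterm _ _) => h; move: (k%:R) (s%:R) k1 k2 d1 d2 s0 => {IHk ks}k {}s k1 k2 d1 d2 s0.
field; do ?[apply/andP; split] => //; apply/eqP; move/eqP: d1; move/eqP: d2; move/eqP: k2; move/eqP: k1; lra.
Qed.

(* Zeilberger certificates for the two recurrences s -> s + 3. *)
Lemma hterm_sum_telescope (s K : nat) : (K < s)%N ->
  \sum_(0 <= k < K.+1)
    (4%:R * s%:R * hterm (s%:R + 3%:R) k - (2%:R * s%:R + 1) * hterm s%:R k) =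
  (2%:R * s%:R - 1 - 4%:R * K%:R) * hterm s%:R K.
Proof.
elim: K => [|K IHK] Ks.
  by rewrite big_nat1 !hterm0; ring.
rewrite big_nat_recr //= IHK 1?ltnW // hterm_shift 1?ltnW // htermS.
have k1 : K%:R + 1 != 0 :> rat by rewrite natr1 pnatr_eq0.
have d1 : K%:R + 1 - s%:R != 0 :> rat by rewrite natr1 subr_eq0 eqr_nat; lia.
have s0 : s%:R != 0 :> rat by rewrite pnatr_eq0; lia.
rewrite !natrM -!(natr1 K).
move: (hterm _ _) => h; move: (K%:R) (s%:R) k1 d1 s0 => {IHK Ks}k {}s k1 d1 s0.
by field; rewrite k1 d1.
Qed.

Lemma hterm_wsum_telescope (s K : nat) : (K < s)%N ->
  \sum_(0 <= k < K.+1)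
    (4%:R * s%:R * (k%:R + 1 + (s%:R + 3%:R)) * hterm (s%:R + 3%:R) k -
     (2%:R * s%:R + 5%:R) * (k%:R + 1 + s%:R) * hterm s%:R k) =
  (- 4%:R * (K%:R + 1) ^+ 2 - (2%:R * s%:R + 13%:R) * (K%:R + 1)
     + (2%:R * s%:R + 3%:R) * (s%:R + 4%:R)) * hterm s%:R K.
Proof.
elim: K => [|K IHK] Ks.
  by rewrite big_nat1 !hterm0; ring.
rewrite big_nat_recr //= IHK 1?ltnW // hterm_shift 1?ltnW // htermS.
have k1 : K%:R + 1 != 0 :> rat by rewrite natr1 pnatr_eq0.
have d1 : K%:R + 1 - s%:R != 0 :> rat by rewrite natr1 subr_eq0 eqr_nat; lia.
have s0 : s%:R != 0 :> rat by rewrite pnatr_eq0; lia.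
rewrite !natrM -!(natr1 K).
move: (hterm _ _) => h; move: (K%:R) (s%:R) k1 d1 s0 => {IHK Ks}k {}s k1 d1 s0.
by field; rewrite k1 d1.
Qed.

(** For s prime to 3 the terms vanish from 3 k >= s on, so the bound s cuts nothing off, and it
    keeps the indices below s as the certificates require. *)
Definition hsum (s : nat) : rat := \sum_(0 <= k < s) hterm s%:R k.

Definition hwsum (s : nat) : rat :=
  \sum_(0 <= k < s) (k%:R + 1 + s%:R) * hterm s%:R k.

Lemma hterm_large (s k : nat) : ~~ (3 %| s)%N -> (s <= 3 * k)%N ->
  hterm s%:R k = 0.
Proof.
by move=> s3 sk; apply: (@hterm_eq0 s (s %/ 3)); move: s3 sk; lia.
Qed.

Lemma hterm_sum_trunc (w : nat -> rat) (s K L : nat) : ~~ (3 %| s)%N ->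
  (K <= L)%N -> (s <= 3 * K)%N ->
  \sum_(0 <= k < L) w k * hterm s%:R k = \sum_(0 <= k < K) w k * hterm s%:R k.
Proof.
move=> s3 KL sK; rewrite (@big_cat_nat _ _ _ K) //= [X in _ + X]big1_seq ?addr0 //.
move=> k /andP[_]; rewrite mem_index_iota => /andP[Kk _].
by rewrite hterm_large ?mulr0 //; lia.
Qed.

Lemma hsum_rec (s : nat) : (1 < s)%N -> ~~ (3 %| s)%N ->
  4%:R * s%:R * hsum (s + 3) = (2%:R * s%:R + 1) * hsum s.
Proof.
case: s => // s s1 s3; apply/eqP; rewrite -subr_eq0; apply/eqP.
have := @hterm_sum_telescope s.+1 s (ltnSn s).
(* The boundary term of the certificate vanishes at the last index; this uses 1 < s. *)
rewrite hterm_large ?mulr0 //; last lia.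
rewrite sumrB -!mulr_sumr => <-; congr (_ * _ - _).
transitivity (\sum_(0 <= k < s.+1 + 3) 1 * hterm (s.+1 + 3)%:R k).
  by apply: eq_bigr => k _; rewrite mul1r.
rewrite (@hterm_sum_trunc (fun=> 1) _ s.+1); [|lia..].
by apply: eq_bigr => k _; rewrite mul1r natrD.
Qed.

Lemma hwsum_rec (s : nat) : (1 < s)%N -> ~~ (3 %| s)%N ->
  4%:R * s%:R * hwsum (s + 3) = (2%:R * s%:R + 5%:R) * hwsum s.
Proof.
case: s => // s s1 s3; apply/eqP; rewrite -subr_eq0; apply/eqP.
have := @hterm_wsum_telescope s.+1 s (ltnSn s).
rewrite hterm_large ?mulr0 //; last lia.
rewrite sumrB; under eq_bigr do rewrite -mulrA.
under [X in _ - X]eq_bigr do rewrite -mulrA.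
rewrite -!mulr_sumr => <-; congr (_ * _ - _).
rewrite /hwsum (@hterm_sum_trunc (fun k => k%:R + 1 + (s.+1 + 3)%:R) _ s.+1); [|lia..].
by apply: eq_bigr => k _; rewrite natrD.
Qed.

Lemma hsum_small :
  [/\ hsum 1 = 1, hsum 2 = 1, hsum 4 = 3%:R / 4%:R,
      hwsum 2 = 3%:R & hwsum 4 = 2%:R * (7%:R / 4%:R)].
Proof.
rewrite /hsum /hwsum; split.
- by rewrite big_nat1 hterm0.
- rewrite big_nat_recr //= big_nat1 (@hterm_eq0 2 0 1) //.
  by rewrite hterm0.
- rewrite !big_nat_recr //= big_nil (@hterm_eq0 4 1 3) // (@hterm_eq0 4 1 2) //.
  by rewrite htermS hterm0; field.
- rewrite big_nat_recr //= big_nat1 (@hterm_eq0 2 0 1) //.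
  by rewrite hterm0; field.
- rewrite !big_nat_recr //= big_nil (@hterm_eq0 4 1 3) // (@hterm_eq0 4 1 2) //.
  by rewrite htermS hterm0; field.
Qed.

Lemma hsum_3n1 n : hsum (3 * n + 1) =
  \prod_(0 <= j < n) ((6 * j + 3)%:R / (4 * (3 * j + 1))%:R).
Proof.
have [f1 _ f4 _ _] := hsum_small.
(* The recurrence requires s > 1, so s = 4 is a second base case. *)
elim: n => [|[_|n IHn]]; first by rewrite big_nil.
  by rewrite big_nat1 f4.
rewrite big_nat_recr //= -IHn.
have -> : (3 * n.+2 + 1 = (3 * n.+1 + 1) + 3)%N by lia.
apply: (@mulfI _ (4 * (3 * n.+1 + 1))%:R); [by rewrite pnatr_eq0; lia|].
rewrite {1}natrM hsum_rec; [|lia..].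
rewrite mulrCA [X in _ = _ * X]mulrC divfK ?pnatr_eq0; last lia.
by rewrite mulrC; congr (_ * _); rewrite -natrM natr1; congr (_%:R); lia.
Qed.

Lemma hsum_3n2 n : hsum (3 * n + 2) =
  \prod_(0 <= j < n) ((6 * j + 5)%:R / (4 * (3 * j + 2))%:R).
Proof.
have [_ f2 _ _ _] := hsum_small.
elim: n => [|n IHn]; first by rewrite big_nil.
rewrite big_nat_recr //= -IHn.
have -> : (3 * n.+1 + 2 = (3 * n + 2) + 3)%N by lia.
apply: (@mulfI _ (4 * (3 * n + 2))%:R); [by rewrite pnatr_eq0; lia|].
rewrite {1}natrM hsum_rec; [|lia..].
rewrite mulrCA [X in _ = _ * X]mulrC divfK ?pnatr_eq0; last lia.
by rewrite mulrC; congr (_ * _); rewrite -natrM natr1; congr (_%:R); lia.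
Qed.

Lemma hwsum_3n1 n : hwsum (3 * n + 1) =
  2%:R * \prod_(0 <= j < n) ((6 * j + 7)%:R / (4 * (3 * j + 1))%:R).
Proof.
elim: n => [|[_|n IHn]]; first by rewrite big_nil muln0 /hwsum big_nat1 hterm0.
  by rewrite big_nat1; case: hsum_small.
rewrite big_nat_recr //= mulrA -IHn.
have -> : (3 * n.+2 + 1 = (3 * n.+1 + 1) + 3)%N by lia.
apply: (@mulfI _ (4 * (3 * n.+1 + 1))%:R); [by rewrite pnatr_eq0; lia|].
rewrite {1}natrM hwsum_rec; [|lia..].
rewrite mulrCA [X in _ = _ * X]mulrC divfK ?pnatr_eq0; last lia.
by rewrite mulrC; congr (_ * _); rewrite -natrM -natrD; congr (_%:R); lia.
Qed.

Lemma hwsum_3n2 n : hwsum (3 * n + 2) =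
  3%:R * \prod_(0 <= j < n) ((6 * j + 9)%:R / (4 * (3 * j + 2))%:R).
Proof.
elim: n => [|n IHn]; first by rewrite big_nil mulr1; case: hsum_small.
rewrite big_nat_recr //= mulrA -IHn.
have -> : (3 * n.+1 + 2 = (3 * n + 2) + 3)%N by lia.
apply: (@mulfI _ (4 * (3 * n + 2))%:R); [by rewrite pnatr_eq0; lia|].
rewrite {1}natrM hwsum_rec; [|lia..].
rewrite mulrCA [X in _ = _ * X]mulrC divfK ?pnatr_eq0; last lia.
by rewrite mulrC; congr (_ * _); rewrite -natrM -natrD; congr (_%:R); lia.
Qed.

Lemma hterm_binomial k :
  hterm 0 k = ('C(2 * k, k) * 'C(3 * k, k))%:R / 24%:R ^+ k.
Proof.
have fact3 j : ((3 * j)`! = 'C(2 * j, j) * 'C(3 * j, j) * j`! ^ 3)%N.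
  have h2 := @bin_fact (2 * j) j; have h3 := @bin_fact (3 * j) j.
  rewrite -h3; last lia.
  have -> : (3 * j - j = 2 * j)%N by lia.
  rewrite -h2; last lia.
  have -> : (2 * j - j = j)%N by lia.
  by lia.
have bE j : ('C(2 * j, j) * 'C(3 * j, j))%:R = (3 * j)`!%:R / j`!%:R ^+ 3 :> rat.
  rewrite fact3 [X in _ = X / _]natrM natrX mulfK //.
  by rewrite expf_eq0 pnatr_eq0 -lt0n fact_gt0.
rewrite bE; elim: k => [|k IHk]; first by rewrite hterm0 expr0 !divr1.
have k1 : k%:R + 1 != 0 :> rat by rewrite natr1 pnatr_eq0.
have f0 : k`!%:R != 0 :> rat by rewrite pnatr_eq0 -lt0n fact_gt0.
rewrite htermS IHk; have -> : (3 * k.+1 = (3 * k).+3)%N by lia.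
rewrite !factS !natrM !exprS -!natr1 natrM.
by field; rewrite f0 k1 expf_neq0.
Qed.

(** Since k = (k + 1) - 1, the left side at K = p is h(0) - f(0) plus twice the first sum of the
    theorem, and the right side is then a multiple of p. *)
Lemma hterm0_sum_telescope K :
  \sum_(0 <= k < K) (k%:R + 2%:R / k.+1%:R) * hterm 0 k =
    8%:R * K%:R * hterm 0 K.
Proof.
elim: K => [|K IHK]; first by rewrite big_nil mulr0 mul0r.
have k1 : K%:R + 1 != 0 :> rat by rewrite natr1 pnatr_eq0.
rewrite big_nat_recr //= IHK htermS -!natr1 natrM.
by field.
Qed.

(** * An alternating binomial sum *)

(** Over any unit ring, because the identity below is proved in [rat] and then transported to
    Z/p^2. *)
Definition harm (R : unitRingType) (n : nat) : R :=
  \sum_(1 <= i < n.+1) i%:R^-1.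

(* Equal to 'C(2n, n - d) / 'C(2n, n), and to 0 for d > n. *)
Definition central_ratio (n d : nat) : rat :=
  \prod_(0 <= i < d) ((n%:R - i%:R) / (n%:R + 1 + i%:R)).

Lemma central_ratioS n d : central_ratio n d.+1 =
  central_ratio n d * ((n%:R - d%:R) / (n%:R + 1 + d%:R)).
Proof. by rewrite /central_ratio big_nat_recr. Qed.

Lemma central_ratio0 n : central_ratio n 0 = 1.
Proof. by rewrite /central_ratio big_nil. Qed.

Lemma natr_addn_neq0 n d : n%:R + 1 + d%:R != 0 :> rat.
Proof. by rewrite natr1 -natrD pnatr_eq0. Qed.

Lemma central_ratio_large n : central_ratio n n.+1 = 0.
Proof. by rewrite central_ratioS subrr mul0r mulr0. Qed.

Lemma bin_central_ratio n d : (d <= n)%N ->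
  'C(2 * n, n - d)%:R = 'C(2 * n, n)%:R * central_ratio n d.
Proof.
elim: d => [|d IHd] dn; first by rewrite subn0 central_ratio0 mulr1.
rewrite central_ratioS mulrA -IHd; last lia.
apply: (mulIf (natr_addn_neq0 n d)); rewrite mulrA divfK ?natr_addn_neq0 //.
rewrite natr1 -natrB -?natrD -?natrM; last lia.
congr (_%:R); have := mul_bin_left (2 * n) (n - d.+1).
have -> : ((n - d.+1).+1 = n - d)%N by lia.
have -> : (2 * n - (n - d.+1) = n.+1 + d)%N by lia.
lia.
Qed.

(** Equivalently, the ratio grows by d^2 / (n + 1)^2 times [central_ratio n.+1 d] from n to n + 1.
    This converts the weight 1 / d into the summable weight d. *)
Lemma central_ratio_shift n d :
  central_ratio n.+1 d * ((n%:R + 1) ^+ 2 - d%:R ^+ 2) =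
  (n%:R + 1) ^+ 2 * central_ratio n d.
Proof.
elim: d => [|d IHd]; first by rewrite !central_ratio0; ring.
have := natr_addn_neq0 n d; have := natr_addn_neq0 n.+1 d.
rewrite !central_ratioS mulrA -IHd -!natr1.
by move=> h1 h2; field; rewrite h1 h2.
Qed.

Lemma central_ratio_alt_sum n : (0 < n)%N ->
  \sum_(1 <= d < n.+1) (-1) ^+ d.-1 * central_ratio n d = 1 / 2%:R.
Proof.
move=> n0.
have nn : n%:R != 0 :> rat by rewrite pnatr_eq0; lia.
(* Gosper summation: every partial sum has a closed form, whose remainder vanishes at M = n. *)
have key M : \sum_(1 <= d < M.+1) (-1) ^+ d.-1 * central_ratio n d =
   1 / 2%:R + (-1) ^+ M.+1 * central_ratio n M * (n%:R - M%:R) / (2%:R * n%:R).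
  elim: M => [|M IHM].
    by rewrite big_geq // central_ratio0; field.
  rewrite big_nat_recr //= IHM central_ratioS !exprS -natr1.
  by have h := natr_addn_neq0 n M; field; rewrite h nn.
by rewrite key subrr mulr0 mul0r addr0.
Qed.

Lemma central_ratio_walt_sum n :
  \sum_(1 <= d < n.+2) (-1) ^+ d.-1 * d%:R * central_ratio n.+1 d =
  n.+1%:R / (2%:R * (2%:R * n%:R + 1)).
Proof.
have nn : 2%:R * n%:R + 1 != 0 :> rat by rewrite -natrM natr1 pnatr_eq0; lia.
have key M :
  \sum_(1 <= d < M.+1) (-1) ^+ d.-1 * d%:R * central_ratio n.+1 d =
  n.+1%:R / (2%:R * (2%:R * n%:R + 1)) +
  (-1) ^+ M.+1 * (2%:R * M%:R + 1) * central_ratio n.+1 M *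
  (n.+1%:R - M%:R) / (2%:R * (2%:R * n%:R + 1)).
  elim: M => [|M IHM].
    by rewrite big_geq // central_ratio0; field.
  rewrite big_nat_recr //= IHM central_ratioS !exprS.
  have h := natr_addn_neq0 n.+1 M; move: h; rewrite -!natr1 => h.
  by field; rewrite h nn.
by rewrite key subrr mulr0 mul0r addr0.
Qed.

(** Induction on n: by [central_ratio_shift] the left side grows by the sum with weight d divided by
    (n + 1)^2, which is 1 / (2n + 1) - 1 / (2n + 2), the growth of the right side. *)
Lemma central_ratio_harm n :
  \sum_(1 <= d < n.+1) (-1) ^+ d.-1 / d%:R * central_ratio n d =
  harm rat (2 * n) - harm rat n.
Proof.
elim: n => [|n IHn]; first by rewrite /harm !big_geq // subrr.
have n1 : n.+1%:R != 0 :> rat by rewrite pnatr_eq0.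
have -> : \sum_(1 <= d < n.+2) (-1) ^+ d.-1 / d%:R * central_ratio n.+1 d =
  \sum_(1 <= d < n.+2) (-1) ^+ d.-1 / d%:R * central_ratio n d +
  (\sum_(1 <= d < n.+2) (-1) ^+ d.-1 * d%:R * central_ratio n.+1 d) / n.+1%:R ^+ 2.
  rewrite mulr_suml -big_split /=; apply: eq_big_seq => d.
  rewrite mem_index_iota => /andP[d1 _].
  have d0 : d%:R != 0 :> rat by rewrite pnatr_eq0; lia.
  apply: (mulfI (expf_neq0 2 n1)); have := central_ratio_shift n d.
  rewrite natr1 => e; rewrite mulrDr [X in _ = X + _]mulrCA -e.
  by rewrite -!natr1 in n1 *; field; rewrite n1 d0.
rewrite big_nat_recr //= central_ratio_large mulr0 addr0 IHn.
rewrite central_ratio_walt_sum /harm.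
have -> : (2 * n.+1 = (2 * n).+2)%N by lia.
rewrite (big_nat_recr (2 * n).+2) // (big_nat_recr (2 * n).+1) //=.
rewrite (big_nat_recr n.+1) //=.
have nn : 2%:R * n%:R + 1 != 0 :> rat by rewrite -natrM natr1 pnatr_eq0; lia.
rewrite -!natr1 natrM in n1 *.
by field; rewrite n1 nn andbT; apply/eqP; move/eqP: n1; lra.
Qed.

(** This sum is the order p correction to the Jacobi sum U. Splitting 2 (n + d) / d = 2 + 2 n / d
    reduces it to the alternating sums of [central_ratio] with weights 1 and 1 / d. *)
Lemma alt_bin_sum n : (0 < n)%N ->
  \sum_(1 <= d < n.+1)
     (-1) ^+ d.-1 * (2 * (n + d) * 'C(2 * n, n - d))%:R / d%:R =
  'C(2 * n, n)%:R * (1 + (2 * n)%:R * (harm rat (2 * n) - harm rat n)).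
Proof.
move=> n0; rewrite -central_ratio_harm.
have one2 : 1 = 2%:R * (1 / 2%:R) :> rat by field.
rewrite [X in _ = _ * (X + _)]one2.
rewrite -(central_ratio_alt_sum n0) 2!mulr_sumr -big_split mulr_sumr /=.
apply: eq_big_seq => d; rewrite mem_index_iota => /andP[d1 dn].
have d0 : d%:R != 0 :> rat by rewrite pnatr_eq0; lia.
by rewrite natrM bin_central_ratio // !natrM natrD; field.
Qed.

(** * Reindexing, orbits of size 3, and the form X^2 + 27 Z^2 *)

Lemma big_nat_reindex (R : Type) (idx : R) (op : Monoid.com_law idx)
    (f : nat -> nat) (a b c d : nat) (F : nat -> R) :
  (b - a = d - c)%N ->
  (forall i, a <= i < b -> c <= f i < d)%N ->
  {in [pred i | a <= i < b]%N &, injective f} ->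
  \big[op/idx]_(c <= j < d) F j = \big[op/idx]_(a <= i < b) F (f i).
Proof.
move=> sz fP finj; rewrite -(big_map f xpredT F).
apply/perm_big; rewrite perm_sym.
have u : uniq [seq f i | i <- index_iota a b].
  rewrite map_inj_in_uniq ?iota_uniq // => x y.
  by rewrite !mem_index_iota; apply: finj.
have [|//|_ e] := @uniq_min_size _ _ (index_iota c d) u.
- by move=> _ /mapP[i + ->]; rewrite !mem_index_iota; apply: fP.
- by rewrite size_map !size_iota sz.
by apply: uniq_perm; rewrite ?iota_uniq.
Qed.

Lemma dvdn3_card (T : finType) (f : T -> T) (A : {set T}) :
  {in A, forall x, [/\ f x \in A, f x != x & f (f (f x)) = x]} -> (3 %| #|A|)%N.
Proof.
have [k] := ubnP #|A|; elim: k A => // k IHk A kA fA.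
have [->|[x xA]] := set_0Vmem A; first by rewrite cards0.
have [fxA fx fx3] := fA x xA; have [ffxA ffx _] := fA _ fxA.
have [_ fffx _] := fA _ ffxA; rewrite fx3 in fffx.
pose B := A :\ x :\ f x :\ f (f x).
have cA : #|A| = (3 + #|B|)%N.
  rewrite (cardsD1 x) xA (cardsD1 (f x)) !inE fx fxA.
  by rewrite (cardsD1 (f (f x))) !inE ffx ffxA eq_sym fffx.
rewrite cA dvdn_addr //; apply: IHk; first by move: kA; rewrite cA; lia.
move=> y; rewrite !inE => /and4P[y2 y1 y0 yA].
have [fyA fy fy3] := fA y yA; split=> //; rewrite fyA andbT.
apply/and3P; split.
- by apply: contraNneq y1 => e; rewrite -fy3 e fx3.
- by apply: contraNneq y0 => e; rewrite -fy3 e fx3.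
- by apply: contraNneq y2 => e; rewrite -fy3 e.
Qed.

(** [Nm] is the norm of a + b w + c w^2 with w a primitive cube root of unity; a, b, c will be the
    sizes of the three cubic classes, so that a + b + c = p - 2. *)
Lemma eisenstein_norm_bounds (a b c : nat) (Nm : int) :
  Nm = a%:Z ^+ 2 + b%:Z ^+ 2 + c%:Z ^+ 2 - a%:Z * b%:Z - b%:Z * c%:Z - a%:Z * c%:Z ->
  0 <= Nm <= (a + b + c)%N%:Z ^+ 2.
Proof.
move=> NmE; apply/andP; split.
  rewrite -(pmulr_rge0 _ (isT : 0 < 4%:Z)).
  have -> : 4%:Z * Nm = (2%:Z * a%:Z - b%:Z - c%:Z) ^+ 2 + 3%:Z * (b%:Z - c%:Z) ^+ 2.
    by rewrite NmE; ring.
  by rewrite addr_ge0 ?sqr_ge0 // mulr_ge0 ?sqr_ge0.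
rewrite -subr_ge0.
have -> : (a + b + c)%N%:Z ^+ 2 - Nm = 3%:Z * (a%:Z * b%:Z + b%:Z * c%:Z + a%:Z * c%:Z).
  by rewrite NmE !PoszD; ring.
by rewrite mulr_ge0 // !addr_ge0 // mulr_ge0.
Qed.

(** Here m - q lies strictly between - q^2 and q^2. Applied to the norm above, this upgrades a
    congruence modulo p^2 to an equality of integers. *)
Lemma small_multiple_eq0 (q : nat) (m k : int) : (1 < q)%N ->
  m - q%:Z = (q ^ 2)%N%:Z * k -> 0 <= m <= (q.-2)%:Z ^+ 2 -> k = 0.
Proof.
move=> q1; have -> : (q ^ 2)%N%:Z = q%:Z * q%:Z by rewrite -PoszM mulnn.
have -> : q.-2%:Z = q%:Z - 2 by lia.
have : 2 <= q%:Z by lia.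
move: (q%:Z) => {q1}q q2 e /andP[m0 m1].
have : -1 < k by rewrite ltNge; apply/negP => k1; nia.
have : k < 1 by rewrite ltNge; apply/negP => k1; nia.
lia.
Qed.

(* q divides (xZ - Xy)(xZ + Xy), and (xX +- 27yZ)^2 + 27(xZ -+ Xy)^2 = 16q^2
   forces the divisible factor to vanish. *)
Lemma norm27_unique (q : nat) (x y X Z : int) : prime q -> (3 < q)%N ->
  4%:Z * q%:Z = x ^+ 2 + 27%:Z * y ^+ 2 ->
  4%:Z * q%:Z = X ^+ 2 + 27%:Z * Z ^+ 2 ->
  (x = 2 %[mod 3])%Z -> (X = 1 %[mod 3])%Z -> x = - X.
Proof.
move=> qp q3 e E x2 X1.
suff : x ^+ 2 = X ^+ 2.
  by move/eqP; rewrite eqf_sqr => /orP[] /eqP xX //; move: x2 X1; rewrite xX; lia.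
have q0 : 0 < q%:Z by rewrite ltz_nat prime_gt0.
suff yZ : y ^+ 2 = Z ^+ 2 by apply: (addIr (27%:Z * y ^+ 2)); rewrite -e yZ E.
suff xZ : (x * Z) ^+ 2 = (X * y) ^+ 2.
  have q4 : 4%:Z * q%:Z != 0 by rewrite mulf_neq0 // gt_eqF.
  apply: (mulfI q4); apply/eqP; rewrite eq_sym -subr_eq0; apply/eqP.
  transitivity ((x * Z) ^+ 2 - (X * y) ^+ 2); last by rewrite xZ subrr.
  by rewrite {1}e E; ring.
have main (s : int) : s ^+ 2 = 1 -> (q%:Z %| x * Z - s * (X * y))%Z ->
    (x * Z) ^+ 2 = (X * y) ^+ 2.
  move=> s1 /dvdzP[k kE].
  have id : (x * X + s * (27%:Z * y * Z)) ^+ 2 + 27%:Z * (x * Z - s * (X * y)) ^+ 2 =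
      16%:Z * q%:Z ^+ 2.
    transitivity ((4%:Z * q%:Z) * (4%:Z * q%:Z)); last by ring.
    rewrite {1}e E.
    transitivity ((x ^+ 2 * X ^+ 2 + 729%:Z * (s ^+ 2 * (y ^+ 2 * Z ^+ 2))) +
      27%:Z * (x ^+ 2 * Z ^+ 2 + s ^+ 2 * (X ^+ 2 * y ^+ 2))); first by ring.
    by rewrite s1; ring.
  rewrite kE in id.
  have k0 : k = 0.
    apply/eqP; apply: contraT => k0.
    have kk : 1 <= k ^+ 2 by rewrite -gtz0_ge1 lt0r sqrf_eq0 k0 sqr_ge0.
    have : 27%:Z * q%:Z ^+ 2 * 1 <= 27%:Z * q%:Z ^+ 2 * k ^+ 2.
      by rewrite ler_pM2l // mulr_gt0 // exprn_gt0.
    have := sqr_ge0 (x * X + s * (27%:Z * y * Z)); have : 0 < q%:Z ^+ 2 by rewrite exprn_gt0.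
    by move: id; rewrite exprMn; lra.
  move/eqP: kE; rewrite k0 mul0r subr_eq0 => /eqP ->.
  by rewrite exprMn s1 mul1r.
have : (q%:Z %| (x * Z - X * y) * (x * Z + X * y))%Z.
  apply/dvdzP; exists (4%:Z * (Z ^+ 2 - y ^+ 2)).
  transitivity (x ^+ 2 * Z ^+ 2 - X ^+ 2 * y ^+ 2); first by ring.
  have -> : x ^+ 2 = 4%:Z * q%:Z - 27%:Z * y ^+ 2 by rewrite e addrK.
  have -> : X ^+ 2 = 4%:Z * q%:Z - 27%:Z * Z ^+ 2 by rewrite E addrK.
  by ring.
rewrite dvdzE abszM /= Euclid_dvdM // => /orP[] qd.
  by apply: (main 1); rewrite ?expr1n // mul1r dvdzE.
by apply: (main (- 1)); rewrite ?sqrrN ?expr1n // mulN1r opprK dvdzE.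
Qed.

(** * Arithmetic modulo p^2 *)

Section ModSquare.

Variables (p : nat) (R : comUnitRingType).
Hypothesis p_prime : prime p.
Hypothesis p_gt3 : (3 < p)%N.
Hypothesis natr_unit : forall a, coprime p a -> (a%:R : R) \is a GRing.unit.
Hypothesis natr_eq0 : forall a, (a%:R == 0 :> R) = (p ^ 2 %| a)%N.

Local Notation P := (p%:R : R).

Lemma p_sqr0 : P * P = 0.
Proof. by apply/eqP; rewrite -natrM natr_eq0 mulnn. Qed.

Lemma natr_lt_unit i : (0 < i < p)%N -> (i%:R : R) \is a GRing.unit.
Proof.
move=> /andP[i0 ip]; apply: natr_unit; rewrite prime_coprime //.
by apply/negP => /(dvdn_leq i0); rewrite leqNgt ip.
Qed.

(** With [p_mul_eq0], this makes multiplication by P the test for congruence modulo p inside R. *)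
Lemma p_mul_modp (a b : nat) : (a = b %[mod p])%N -> P * a%:R = P * b%:R.
Proof.
move=> ab; rewrite (divn_eq a p) (divn_eq b p) ab !natrD !natrM !mulrDr.
by rewrite ![P * (_ * P)]mulrCA p_sqr0 !mulr0 !add0r.
Qed.

Lemma p_mul_eq0 (a : nat) : (P * a%:R == 0) = (p %| a)%N.
Proof.
by rewrite -natrM natr_eq0 -mulnn dvdn_pmul2l // prime_gt0.
Qed.

(* First-order expansions: P^2 = 0, so 1 + P x behaves like exp (P x). *)
Lemma mul_1addp x y : (1 + P * x) * (1 + P * y) = 1 + P * (x + y).
Proof.
rewrite mulrDr mulr1 mulrDl mul1r mulrACA p_sqr0 mul0r addr0.
by rewrite -addrA mulrDr.
Qed.

Lemma mul_1subp x y : (1 - P * x) * (1 - P * y) = 1 - P * (x + y).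
Proof. by rewrite -!mulrN mul_1addp opprD. Qed.

Lemma mul_1addp_1subp x y : (1 + P * x) * (1 - P * y) = 1 + P * (x - y).
Proof. by rewrite -mulrN mul_1addp. Qed.

Lemma p_mul_1addp x : P * (1 + P * x) = P.
Proof. by rewrite mulrDr mulr1 mulrA p_sqr0 mul0r addr0. Qed.

Lemma prod_add_p (r : seq nat) (F E : nat -> R) :
  {in r, forall i, F i \is a GRing.unit} ->
  \prod_(i <- r) (F i + P * E i) =
  \prod_(i <- r) F i * (1 + P * \sum_(i <- r) E i / F i).
Proof.
elim: r => [|i r IHr] Fu; first by rewrite !big_nil mulr0 addr0 mul1r.
have Fi : F i \is a GRing.unit by apply: Fu; rewrite inE eqxx.
rewrite !big_cons IHr => [|j jr]; last by apply: Fu; rewrite inE jr orbT.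
rewrite -mul_1addp.
have -> : F i + P * E i = F i * (1 + P * (E i / F i)).
  by rewrite mulrDr mulr1 mulrCA [F i * _]mulrCA mulrV // mulr1.
by rewrite mulrACA.
Qed.

(** * Products and harmonic sums over blocks of consecutive integers *)

Definition range_prod a b : R := \prod_(a.+1 <= i < b.+1) i%:R.
Definition range_harm a b : R := \sum_(a.+1 <= i < b.+1) i%:R^-1.

Lemma range_prod_cat b a c : (a <= b <= c)%N -> range_prod a c = range_prod a b * range_prod b c.
Proof. by move=> /andP[ab bc]; rewrite -big_cat_nat. Qed.

Lemma range_harm_cat b a c : (a <= b <= c)%N -> range_harm a c = range_harm a b + range_harm b c.
Proof. by move=> /andP[ab bc]; rewrite -big_cat_nat. Qed.

Lemma range_prod_fact b : range_prod 0 b = b`!%:R.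
Proof. by rewrite fact_prod natr_prod. Qed.

Lemma range_prod_unit a b : (b < p)%N -> range_prod a b \is a GRing.unit.
Proof.
move=> bp; rewrite /range_prod big_seq_cond; apply: rpred_prod => i.
rewrite andbT mem_index_iota => /andP[ai ib].
by apply: natr_lt_unit; rewrite (leq_trans _ ai) // (leq_trans ib).
Qed.

Lemma prod_lin_p a b (c e : R) : (b < p)%N -> c \is a GRing.unit ->
  \prod_(a.+1 <= i < b.+1) (c * i%:R + P * e) =
  c ^+ (b - a) * range_prod a b * (1 + P * (e / c * range_harm a b)).
Proof.
move=> bp cu; have iu i : i \in index_iota a.+1 b.+1 -> i%:R \is a @GRing.unit R.
  rewrite mem_index_iota => /andP[ai ib].
  by apply: natr_lt_unit; rewrite (leq_trans _ ai) // (leq_trans ib).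
rewrite prod_add_p => [|i /iu ui]; last by rewrite unitrM cu.
rewrite big_split /= big_const_nat subSS iter_mulr_1.
congr (_ * (1 + _ * _)); rewrite mulr_sumr; apply: eq_big_seq => i /iu ui.
by rewrite invrM // mulrA mulrAC.
Qed.

(** Substitute p - i = - i (1 - p / i), which maps the block a < i <= b onto p - 1 - b < i <= p - 1
    - a. *)
Lemma range_prod_reflect a b : (a <= b < p)%N ->
  range_prod (p.-1 - b) (p.-1 - a) = (-1) ^+ (b - a) * range_prod a b * (1 - P * range_harm a b).
Proof.
move=> /andP[ab bp].
have u1 : (-1 : R) \is a GRing.unit by rewrite unitrN unitr1.
have := @prod_lin_p a b (-1) 1 bp u1.
rewrite invrN1 mul1r mulN1r mulrN => <-.
rewrite /range_prod (@big_nat_reindex _ _ _ (fun i => p - i)%N a.+1 b.+1); [|lia..|].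
  apply: eq_big_seq => i; rewrite mem_index_iota => /andP[ai ib].
  by rewrite natrB; [rewrite mulr1 mulN1r addrC|lia].
by move=> x y; rewrite !inE; lia.
Qed.

Lemma range_harm_reflect a b : (a <= b < p)%N ->
  P * range_harm (p.-1 - b) (p.-1 - a) = - (P * range_harm a b).
Proof.
move=> /andP[ab bp].
rewrite /range_harm (@big_nat_reindex _ _ _ (fun i => p - i)%N a.+1 b.+1); [|lia..|].
  rewrite !mulr_sumr -sumrN; apply: eq_big_seq => i.
  rewrite mem_index_iota => /andP[ai ib].
  have ui : i%:R \is a @GRing.unit R by apply: natr_lt_unit; lia.
  have upi : (p - i)%:R \is a @GRing.unit R by apply: natr_lt_unit; lia.
  apply: (mulIr ui); apply: (mulIr upi); rewrite mulNr !mulrVK // mulrAC mulrVK //.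
  rewrite natrB; last lia.
  by rewrite mulNr mulrBr p_sqr0 sub0r opprK.
by move=> x y; rewrite !inE; lia.
Qed.

Lemma prod_even_odd M :
  \prod_(1 <= i < (2 * M).+1) i%:R =
  2%:R ^+ M * range_prod 0 M * \prod_(0 <= j < M) (2 * j + 1)%:R :> R.
Proof.
elim: M => [|M IHM]; first by rewrite /range_prod !big_geq // !mulr1.
have -> : (2 * M.+1 = (2 * M).+2)%N by lia.
rewrite big_nat_recr // big_nat_recr //= IHM.
rewrite [X in _ = _ * X]big_nat_recr //= (@range_prod_cat M 0 M.+1) ?leqnSn //.
have -> : range_prod M M.+1 = M.+1%:R by rewrite /range_prod big_nat1.
have -> : (2 * M).+1%:R = 2%:R * M%:R + 1 :> R by rewrite -natr1 natrM.
have -> : (2 * M).+2%:R = 2%:R * (M%:R + 1) :> R by rewrite natr1 -natrM mulnS.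
have -> : (2 * M + 1)%:R = 2%:R * M%:R + 1 :> R by rewrite addn1 -natr1 natrM.
by rewrite exprS -(natr1 M); ring.
Qed.

Lemma p_mul_fermat a : coprime p a -> P * a%:R ^+ p.-1 = P.
Proof.
move=> pa; apply: (mulIr (natr_unit pa)).
rewrite -mulrA -exprSr prednK ?prime_gt0 // -natrX.
by apply: p_mul_modp; apply: fermat_little.
Qed.

(** Every product below is an arithmetic progression whose factors are rewritten as c i + p e with i
    running through a block. Here i decreases with j (i = a + M - j); in [prod_AP_up] it increases
    (i = a + 1 + j). *)
Lemma prod_AP_down (F : nat -> R) a M c e :
  (a + M < p)%N -> c \is a GRing.unit ->
  (forall i, (a < i <= a + M)%N -> F (a + M - i)%N = c * i%:R + P * e) ->
  \prod_(0 <= j < M) F j =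
    c ^+ M * range_prod a (a + M) * (1 + P * (e / c * range_harm a (a + M))).
Proof.
move=> aMp cu FE; have := @prod_lin_p a (a + M) c e aMp cu.
rewrite addKn => <-.
rewrite (@big_nat_reindex _ _ _ (fun i => a + M - i)%N a.+1 (a + M).+1).
- by apply: eq_big_seq => i; rewrite mem_index_iota => /FE.
- by rewrite subn0 subSS addKn.
- by move=> i; lia.
by move=> x y; rewrite !inE; lia.
Qed.

Lemma prod_AP_up (F : nat -> R) a M c e :
  (a + M < p)%N -> c \is a GRing.unit ->
  (forall i, (a < i <= a + M)%N -> F (i - a.+1)%N = c * i%:R + P * e) ->
  \prod_(0 <= j < M) F j =
    c ^+ M * range_prod a (a + M) * (1 + P * (e / c * range_harm a (a + M))).
Proof.
move=> aMp cu FE; have := @prod_lin_p a (a + M) c e aMp cu.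
rewrite addKn => <-.
rewrite (@big_nat_reindex _ _ _ (fun i => i - a.+1)%N a.+1 (a + M).+1).
- by apply: eq_big_seq => i; rewrite mem_index_iota => /FE.
- by rewrite subn0 subSS addKn.
- by move=> i; lia.
by move=> x y; rewrite !inE; lia.
Qed.

Lemma prod_div (I : eqType) (r : seq I) (F G : I -> R) :
  {in r, forall i, G i \is a GRing.unit} ->
  (\prod_(i <- r) (F i / G i)) * \prod_(i <- r) G i = \prod_(i <- r) F i.
Proof.
by move=> Gu; rewrite -big_split; apply: eq_big_seq => i /Gu Gi /=; rewrite divrK.
Qed.

Lemma natr_le3_unit a : (0 < a <= 3)%N -> (a%:R : R) \is a GRing.unit.
Proof. by move=> a3; apply: natr_lt_unit; lia. Qed.

Lemma unit2 : (2%:R : R) \is a GRing.unit. Proof. exact: natr_le3_unit. Qed.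
Lemma unit3 : (3%:R : R) \is a GRing.unit. Proof. exact: natr_le3_unit. Qed.
#[local] Hint Resolve unit2 unit3 : core.

(* Below, B_r is the product and s_r the harmonic sum over the block
   (r-1)N < i <= rN of the interval [1, p-1] = [1, 6N]. *)
Section SixN.

Variable N : nat.
Hypothesis pN : p = (6 * N + 1)%N.

Local Notation u := ((2%:R : R) ^+ N).
Local Notation t := ((3%:R : R) ^+ N).
Local Notation eps := ((-1 : R) ^+ N).
Local Notation B1 := (range_prod 0 N).
Local Notation B2 := (range_prod N (2 * N)).
Local Notation B3 := (range_prod (2 * N) (3 * N)).
Local Notation s1 := (range_harm 0 N).
Local Notation s2 := (range_harm N (2 * N)).
Local Notation s3 := (range_harm (2 * N) (3 * N)).
Local Notation B4 := (range_prod (3 * N) (4 * N)).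
Local Notation B5 := (range_prod (4 * N) (5 * N)).
Local Notation B6 := (range_prod (5 * N) (6 * N)).

Lemma B4_reflect : B4 = eps * B3 * (1 - P * s3).
Proof.
have -> : B4 = range_prod (p.-1 - 3 * N) (p.-1 - 2 * N) by congr range_prod; lia.
by rewrite range_prod_reflect; [congr (_ ^+ _ * _ * _); lia|lia].
Qed.

Lemma B5_reflect : B5 = eps * B2 * (1 - P * s2).
Proof.
have -> : B5 = range_prod (p.-1 - 2 * N) (p.-1 - N) by congr range_prod; lia.
by rewrite range_prod_reflect; [congr (_ ^+ _ * _ * _); lia|lia].
Qed.

Lemma B6_reflect : B6 = eps * B1 * (1 - P * s1).
Proof.
have -> : B6 = range_prod (p.-1 - N) (p.-1 - 0) by congr range_prod; lia.
by rewrite range_prod_reflect; [congr (_ ^+ _ * _ * _); lia|lia].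
Qed.

Lemma prod_odd M : (M <= 3 * N)%N ->
  \prod_(0 <= j < M) (2 * j + 1)%:R = (- 2%:R) ^+ M *
    range_prod (3 * N - M) (3 * N) * (1 - P * (range_harm (3 * N - M) (3 * N) / 2%:R)).
Proof.
(* As p = 6 N + 1, the factor 2 j + 1 is p - 2 i for i = 3 N - j. *)
move=> MN; rewrite (@prod_AP_down _ (3 * N - M) M (- 2%:R) 1) ?unitrN //; last 2 first.
- by lia.
- move=> i iM; rewrite mulNr mulr1 -natrM addrC; apply/eqP.
  by rewrite eq_sym subr_eq -natrD; apply/eqP; congr (_%:R); lia.
have -> : (3 * N - M + M = 3 * N)%N by lia.
by rewrite invrN mul1r mulNr mulrN [_^-1 * _]mulrC.
Qed.

Lemma B56 : range_prod (4 * N) (6 * N) = B5 * B6.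
Proof. by rewrite (@range_prod_cat (5 * N)); last lia. Qed.

Lemma range_prod_unit_6N a b : (b <= 6 * N)%N -> range_prod a b \is a GRing.unit.
Proof. by move=> b6; apply: range_prod_unit; lia. Qed.

Lemma pow2N_unit : u \is a GRing.unit. Proof. exact: unitrX. Qed.

Lemma eps_sqr1 : eps * eps = 1.
Proof. by rewrite -exprMn mulrNN mulr1 expr1n. Qed.

Lemma B12 : range_prod 0 (2 * N) = B1 * B2.
Proof. by apply: range_prod_cat; lia. Qed.

Lemma B23 : range_prod N (3 * N) = B2 * B3.
Proof. by apply: range_prod_cat; lia. Qed.

Lemma B34 : range_prod (2 * N) (4 * N) = B3 * B4.
Proof. by apply: range_prod_cat; lia. Qed.

Lemma exprN_2N c : (- c) ^+ (2 * N) = (c ^+ N) ^+ 2 :> R.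
Proof. by rewrite exprM sqrrN -exprM mulnC exprM. Qed.

Lemma expr_2N c : c ^+ (2 * N) = (c ^+ N) ^+ 2 :> R.
Proof. by rewrite mulnC exprM. Qed.

(* Separate the even and odd factors of (4N)! (and of (2N)! in the next lemma),
   writing the odd ones as p - 2i. *)
Lemma B4_duplication : B4 = u ^+ 4 * B2 * (1 - P * ((s2 + s3) / 2%:R)).
Proof.
have := prod_even_odd (2 * N); rewrite prod_odd; last lia.
have -> : (3 * N - 2 * N = N)%N by lia.
have -> : (2 * (2 * N) = 4 * N)%N by lia.
rewrite (range_harm_cat (_ : N <= 2 * N <= 3 * N)%N); last lia.
rewrite -[\prod_(1 <= i < _) _]/(range_prod 0 (4 * N)).
rewrite (@range_prod_cat (2 * N) 0); last lia.
rewrite B34 B23 exprN_2N B12 expr_2N => e.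
apply: (mulrI (range_prod_unit_6N 0 (leq_pmull N (isT : 0 < 6)%N))).
apply: (mulrI (range_prod_unit_6N N (_ : 2 * N <= 6 * N)%N)); first by lia.
apply: (mulrI (range_prod_unit_6N (2 * N) (_ : 3 * N <= 6 * N)%N)); first by lia.
transitivity (B1 * B2 * (B3 * B4)); first by ring.
by rewrite e; ring.
Qed.

Lemma B2_duplication : B2 = eps * u ^+ 2 * B3 * (1 - P * (s3 / 2%:R)).
Proof.
have := prod_even_odd N; rewrite prod_odd; last lia.
have -> : (3 * N - N = 2 * N)%N by lia.
rewrite -[\prod_(1 <= i < _) _]/(range_prod 0 (2 * N)) B12 exprNn => e.
apply: (mulrI (range_prod_unit_6N 0 (leq_pmull N (isT : 0 < 6)%N))).
by rewrite e; ring.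
Qed.

(** Since 6 N = p - 1, this is the Fermat quotient of 2. It comes from equating the reflection and
    duplication formulas for B4 and eliminating B2 by its own duplication formula. *)
Lemma pow2_6N : u ^+ 6 = 1 + P * (s2 / 2%:R).
Proof.
have h := B4_duplication; rewrite B4_reflect B2_duplication in h.
have {}h : 1 - P * s3 = u ^+ 6 * (1 - P * ((s2 + s3) / 2%:R + s3 / 2%:R)).
  have eU : eps \is a GRing.unit by apply: unitrX; rewrite unitrN unitr1.
  apply: (mulrI eU); apply: (mulrI (range_prod_unit_6N (2 * N) (_ : 3 * N <= 6 * N)%N)).
    by lia.
  by rewrite mulrA [_ * eps]mulrC h -mul_1subp; ring.
have {h} := congr1 ( *%R^~ (1 + P * (s3 + s2 / 2%:R))) h.
rewrite -!mulrN -mulrA !mul_1addp.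
have -> : - ((s2 + s3) / 2 + s3 / 2%:R) + (s3 + s2 / 2%:R) = 0.
  by rewrite -[s3 in X in _ + X](divrK unit2); ring.
by rewrite mulr0 addr0 mulr1 addrA addNr add0r => <-.
Qed.

Local Notation C := ('C(2 * (2 * N), 2 * N)%:R : R).

Lemma central_bin_blocks : C * B1 * B2 = B3 * B4.
Proof.
apply: (mulrI (range_prod_unit_6N 0 (_ : 2 * N <= 6 * N)%N)); first by lia.
rewrite -B34 -range_prod_cat; last by lia.
rewrite -mulrA -B12 !range_prod_fact mulrCA -!natrM; congr (_%:R).
have := @bin_fact (2 * (2 * N)) (2 * N).
have -> : (2 * (2 * N) - 2 * N = 2 * N)%N by lia.
have -> : (2 * (2 * N) = 4 * N)%N by lia.
by move=> ->; last lia.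
Qed.

Lemma B3_duplication : eps * u ^+ 2 * B3 = B2 * (1 + P * (s3 / 2%:R)).
Proof. by rewrite [in RHS]B2_duplication -[RHS]mulrA -mulrN mul_1addp addNr mulr0 addr0 mulr1. Qed.

Lemma addr_half x : x / 2%:R + x / 2%:R = x :> R.
Proof. by rewrite -mulrDl -mulr2n -[X in X / _]mulr_natr mulrK. Qed.

(** No correction of order p survives: reflecting B4 contributes - s3, and the duplication of B3,
    used twice, contributes 2 (s3 / 2). *)
Lemma central_bin_B2 : C * B1 * u ^+ 4 = eps * B2.
Proof.
apply: (mulrI (range_prod_unit_6N N (_ : 2 * N <= 6 * N)%N)); first by lia.
transitivity (u ^+ 4 * (C * B1 * B2)); first by ring.
rewrite central_bin_blocks B4_reflect.
transitivity (eps * (1 - P * s3) * (eps * eps) * (eps * u ^+ 2 * B3) ^+ 2).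
  by rewrite eps_sqr1 exprMn exprMn [eps ^+ 2]expr2 eps_sqr1; ring.
rewrite B3_duplication eps_sqr1 exprMn [(1 + _) ^+ 2]expr2 mul_1addp addr_half.
transitivity (eps * B2 ^+ 2 * ((1 - P * s3) * (1 + P * s3))); first by ring.
by rewrite -mulrN mul_1addp addNr mulr0 addr0; ring.
Qed.

(** A, B, H, H2 are the images in R of [hsum p], [hsum (2 * p)], [hwsum p] and [hwsum (2 * p)], as p
    = 3 (2 N) + 1 and 2 p = 3 (4 N) + 2. *)
Local Notation A := (\prod_(0 <= j < 2 * N) ((6 * j + 3)%:R / (4 * (3 * j + 1))%:R) : R).
Local Notation B := (\prod_(0 <= j < 4 * N) ((6 * j + 5)%:R / (4 * (3 * j + 2))%:R) : R).
Local Notation H := (2%:R * \prod_(0 <= j < 2 * N) ((6 * j + 7)%:R / (4 * (3 * j + 1))%:R) : R).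
Local Notation H2 := (3%:R * \prod_(0 <= j < 4 * N) ((6 * j + 9)%:R / (4 * (3 * j + 2))%:R) : R).

Lemma unit4 : (4%:R : R) \is a GRing.unit.
Proof. by rewrite -[4%N]/(2 * 2)%N natrM unitrM unit2. Qed.

Lemma unit12 : (12%:R : R) \is a GRing.unit.
Proof. by rewrite -[12%N]/(2 * (2 * 3))%N !natrM !unitrM unit2 unit3. Qed.

Lemma unit6 : (6%:R : R) \is a GRing.unit.
Proof. by rewrite -[6%N]/(2 * 3)%N natrM unitrM unit2 unit3. Qed.

Lemma expr6_N : (6%:R : R) ^+ N = u * t.
Proof.
have -> : 6%:R = 2%:R * 3%:R :> R by ring.
exact: exprMn.
Qed.

#[local] Hint Resolve unit4 unit12 unit6 : core.

Lemma den1_unit j : (j < 2 * N)%N -> (4 * (3 * j + 1))%:R \is a @GRing.unit R.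
Proof.
by move=> jN; rewrite natrM unitrM unit4 natr_lt_unit //; lia.
Qed.

Lemma den2_unit j : (j < 4 * N)%N -> (4 * (3 * j + 2))%:R \is a @GRing.unit R.
Proof.
move=> jN; rewrite natrM unitrM unit4 /=.
apply: natr_unit; rewrite prime_coprime //; apply/negP => /dvdnP[k e].
(* 3 j + 2 is positive and less than 2 p, and it differs from p modulo 3. *)
by case: k e => [|[|k]]; move: pN jN; nia.
Qed.

Lemma expr12_kN k : (12%:R : R) ^+ (k * N) = u ^+ (2 * k) * t ^+ k.
Proof.
have -> : 12%:R = 2%:R ^+ 2 * 3%:R :> R by ring.
by rewrite exprMn -!exprM; congr (_ ^+ _ * _ ^+ _); lia.
Qed.

Lemma expr6_kN k : (6%:R : R) ^+ (k * N) = u ^+ k * t ^+ k.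
Proof.
have -> : 6%:R = 2%:R * 3%:R :> R by ring.
by rewrite exprMn -!exprM; congr (_ ^+ _ * _ ^+ _); lia.
Qed.

Lemma prod_den1E : \prod_(0 <= j < 2 * N) (4 * (3 * j + 1))%:R =
  u ^+ 4 * t ^+ 2 * (B1 * B2) * (1 - P * ((s1 + s2) / 3%:R)) :> R.
Proof.
(* 4 (3 j + 1) = 4 p - 12 i for i = 2 N - j. *)
rewrite (@prod_AP_down _ 0 (2 * N) (- 12%:R) 4%:R) ?unitrN //; last 2 first.
- by lia.
- move=> i iM; rewrite mulNr -!natrM addrC; apply/eqP.
  by rewrite eq_sym subr_eq -natrD; apply/eqP; congr (_%:R); lia.
have -> : (- 12%:R) ^+ (2 * N) = u ^+ 4 * t ^+ 2 :> R.
  by rewrite exprN_2N -[LHS]expr_2N expr12_kN.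
rewrite add0n B12.
rewrite (@range_harm_cat N 0); last by lia.
rewrite invrN mulrN mulNr mulrN; congr (_ * (1 - _ * _)).
rewrite mulrC; congr (_ * _); apply: (mulIr unit12); rewrite mulrVK //.
by rewrite -[12%N]/(3 * 4)%N natrM mulKr.
Qed.

(** The block is stable under i -> p - i, which changes the sign of 1 / i modulo p. *)
Lemma range_harm_mid : P * range_harm (2 * N) (4 * N) = 0.
Proof.
rewrite (@range_harm_cat (3 * N)); last by lia.
rewrite mulrDr; have -> : range_harm (3 * N) (4 * N) = range_harm (p.-1 - 3 * N) (p.-1 - 2 * N).
  by congr range_harm; lia.
by rewrite range_harm_reflect ?subrr //; lia.
Qed.

Lemma range_harm_top : P * range_harm (4 * N) (6 * N) = - (P * (s1 + s2)).
Proof.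
have -> : range_harm (4 * N) (6 * N) = range_harm (p.-1 - 2 * N) (p.-1 - 0).
  by congr range_harm; lia.
by rewrite range_harm_reflect; [rewrite (@range_harm_cat N 0 (2 * N)) //; lia|lia].
Qed.

Lemma prod_den2E : \prod_(0 <= j < 4 * N) (4 * (3 * j + 2))%:R =
  u ^+ 8 * t ^+ 4 * (B3 * B4 * (B5 * B6)) * (1 + P * ((s1 + s2) / 3%:R)) :> R.
Proof.
(* 4 (3 j + 2) = 12 i - 4 p for i = j + 2 N + 1. *)
rewrite (@prod_AP_up _ (2 * N) (4 * N) 12%:R (- 4%:R)) //; last 2 first.
- by lia.
- move=> i iM; rewrite mulrN -!natrM; apply/eqP.
  by rewrite eq_sym subr_eq -natrD; apply/eqP; congr (_%:R); lia.
have -> : (2 * N + 4 * N = 6 * N)%N by lia.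
rewrite expr12_kN (@range_prod_cat (4 * N)); last by lia.
rewrite B34 B56; congr (_ * (1 + _)).
rewrite mulrCA (@range_harm_cat (4 * N)); last by lia.
rewrite mulrDr range_harm_mid range_harm_top add0r [X in X * - _]mulNr mulrNN mulrCA; congr (_ * _).
rewrite mulrC; congr (_ * _); apply: (mulIr unit12); rewrite mulrVK //.
by rewrite -[12%N]/(3 * 4)%N natrM mulKr.
Qed.

Lemma numA : \prod_(0 <= j < 2 * N) (6 * j + 3)%:R =
  u ^+ 2 * t ^+ 2 * (B2 * B3) * (1 - P * ((s2 + s3) / 2%:R)) :> R.
Proof.
transitivity (\prod_(0 <= j < 2 * N) (3%:R * (2 * j + 1)%:R) : R).
  by apply: eq_bigr => j _; rewrite -natrM; congr (_%:R); lia.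
rewrite big_split /= prodr_const_nat prod_odd; last by lia.
have -> : (3 * N - 2 * N = N)%N by lia.
rewrite subn0 exprN_2N expr_2N B23 (@range_harm_cat (2 * N)); last by lia.
by ring.
Qed.

Lemma numB : \prod_(0 <= j < 4 * N) (6 * j + 5)%:R =
  u ^+ 4 * t ^+ 4 * (B2 * (B3 * B4) * B5) :> R.
Proof.
(* 6 j + 5 = 6 i - p for i = j + N + 1. *)
rewrite (@prod_AP_up _ N (4 * N) 6%:R (- 1)) //; last 2 first.
- by lia.
- move=> i iM; rewrite mulrN1 -!natrM; apply/eqP.
  by rewrite eq_sym subr_eq -natrD; apply/eqP; congr (_%:R); lia.
have -> : (N + 4 * N = 5 * N)%N by lia.
rewrite expr6_kN (@range_prod_cat (2 * N)); last by lia.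
rewrite [range_prod (2 * N) (5 * N)](@range_prod_cat (4 * N)); last by lia.
rewrite B34 [P * (_ * _)]mulrCA.
suff -> : P * range_harm N (5 * N) = 0 by rewrite mulr0 addr0 mulr1 !mulrA.
rewrite (@range_harm_cat (4 * N)); last by lia.
rewrite (@range_harm_cat (2 * N)); last by lia.
rewrite mulrDr mulrDr range_harm_mid addr0.
have -> : range_harm (4 * N) (5 * N) = range_harm (p.-1 - 2 * N) (p.-1 - N).
  by congr range_harm; lia.
by rewrite range_harm_reflect ?subrr //; lia.
Qed.

(* Valid because - 6 N = 1 - p. *)
Lemma p_mul_N6N x : P * ((- 6%:R) * N%:R * x) = P * x.
Proof.
rewrite mulrA mulNr; have -> : 6%:R * N%:R = P - 1 :> R.
  by rewrite pN natrD -natrM addrK.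
by rewrite opprB mulrBr mulr1 p_sqr0 subr0.
Qed.

Lemma range_prod_last k : (0 < k)%N -> range_prod 0 k = range_prod 0 k.-1 * k%:R.
Proof. by case: k => // k _; rewrite /range_prod big_nat_recr. Qed.

(** The factor j = N - 1 is p itself, those before it are p - 6 i and those after it p + 6 i. The
    cofactor of p matters only modulo p, so no harmonic sum remains. *)
Lemma numH : (0 < N)%N -> \prod_(0 <= j < 2 * N) (6 * j + 7)%:R =
  P * (eps * u ^+ 2 * t ^+ 2 * B1 ^+ 2) :> R.
Proof.
move=> N0; rewrite (@big_cat_nat _ _ _ N.-1) /=; [|lia..].
rewrite (@prod_AP_down _ 0 N.-1 (- 6%:R) 1) ?unitrN //; last 2 first.
- by lia.
- move=> i iM; rewrite mulNr mulr1 -!natrM addrC; apply/eqP.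
  by rewrite eq_sym subr_eq -natrD; apply/eqP; congr (_%:R); lia.
rewrite big_ltn; last by lia.
have -> : \prod_(N.-1.+1 <= j < 2 * N) (6 * j + 7)%:R = 6%:R ^+ N * B1 *
    (1 + P * (1 / 6%:R * s1)) :> R.
  rewrite prednK // -[X in \prod_(X <= _ < _) _]add0n big_addn.
  have -> : (2 * N - N = N)%N by lia.
  rewrite (@prod_AP_up _ 0 N 6%:R 1) ?add0n //; first by lia.
  by move=> i iM; rewrite mulr1 -natrM -natrD; congr (_%:R); lia.
have -> : (6 * N.-1 + 7 = p)%N by lia.
rewrite add0n; set x := _ / - _ * _; set y := _ * s1.
transitivity ((- 6%:R) ^+ N.-1 * range_prod 0 N.-1 * 6%:R ^+ N * B1 *
   (P * (1 + P * x) * (1 + P * y))); first by ring.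
(* Only N - 1 factors precede p; inserting - 6 N, which is 1 modulo p, completes them to (-6)^N
   N!. *)
rewrite !p_mul_1addp mulrC -[LHS]p_mul_N6N.
transitivity (P * ((- 6%:R) ^+ N.-1 * - 6%:R * (range_prod 0 N.-1 * N%:R) * 6%:R ^+ N * B1)).
  by ring.
rewrite -exprSr prednK // -range_prod_last // exprNn expr6_N.
by ring.
Qed.

(** As in [numH], with the factor 3 p at j = 3 N - 1 and the neighbours 3 p - 6 i and 3 p + 6 i. *)
Lemma numH2 : (0 < N)%N -> \prod_(0 <= j < 4 * N) (6 * j + 9)%:R =
  P * (eps * u ^+ 4 * t ^+ 4 * B1 ^+ 2 * B2 * B3) :> R.
Proof.
move=> N0; rewrite (@big_cat_nat _ _ _ (3 * N).-1) /=; [|lia..].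
rewrite (@prod_AP_down _ 0 (3 * N).-1 (- 6%:R) 3%:R) ?unitrN //; last 2 first.
- by lia.
- move=> i iM; rewrite mulNr -!natrM addrC; apply/eqP.
  by rewrite eq_sym subr_eq -natrD; apply/eqP; congr (_%:R); lia.
rewrite big_ltn; last by lia.
have -> : \prod_((3 * N).-1.+1 <= j < 4 * N) (6 * j + 9)%:R = 6%:R ^+ N * B1 *
    (1 + P * (3%:R / 6%:R * s1)) :> R.
  rewrite prednK; last by lia.
  rewrite -[X in \prod_(X <= _ < _) _]add0n big_addn.
  have -> : (4 * N - 3 * N = N)%N by lia.
  rewrite (@prod_AP_up _ 0 N 6%:R 3%:R) ?add0n //; first by lia.
  by move=> i iM; rewrite -!natrM -natrD; congr (_%:R); lia.
have -> : (6 * (3 * N).-1 + 9 = 3 * p)%N by lia.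
rewrite add0n natrM; set x := _ / - _ * _; set y := _ * s1.
transitivity (3%:R * ((- 6%:R) ^+ (3 * N).-1 * range_prod 0 (3 * N).-1 * 6%:R ^+ N * B1) *
   (P * (1 + P * x) * (1 + P * y))); first by ring.
rewrite !p_mul_1addp mulrC -[LHS]p_mul_N6N.
transitivity (P * ((- 6%:R) ^+ (3 * N).-1 * - 6%:R * (range_prod 0 (3 * N).-1 * (3 * N)%:R) * 6%:R ^+ N * B1)).
  by rewrite natrM; ring.
have N3 : (0 < 3 * N)%N by lia.
rewrite -exprSr prednK // -range_prod_last // exprNn expr6_kN expr6_N.
rewrite (@range_prod_cat (2 * N) 0); last by lia.
have -> : (-1) ^+ (3 * N) = eps :> R by rewrite mulnC exprM exprS expr2 eps_sqr1 mulr1.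
by rewrite B12; ring.
Qed.

Lemma N_gt0 : (0 < N)%N.
Proof. by move: pN p_gt3; case: N; lia. Qed.

Lemma pow3N_unit : t \is a GRing.unit. Proof. by apply: unitrX. Qed.

Lemma B1_unit : B1 \is a GRing.unit. Proof. by apply: range_prod_unit_6N; lia. Qed.
Lemma B2_unit : B2 \is a GRing.unit. Proof. by apply: range_prod_unit_6N; lia. Qed.
Lemma B3_unit : B3 \is a GRing.unit. Proof. by apply: range_prod_unit_6N; lia. Qed.
Lemma B4_unit : B4 \is a GRing.unit. Proof. by apply: range_prod_unit_6N; lia. Qed.
Lemma B5_unit : B5 \is a GRing.unit. Proof. by apply: range_prod_unit_6N; lia. Qed.
Lemma prod_den1 (F : nat -> R) :
  (\prod_(0 <= j < 2 * N) (F j / (4 * (3 * j + 1))%:R)) *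
    \prod_(0 <= j < 2 * N) (4 * (3 * j + 1))%:R = \prod_(0 <= j < 2 * N) F j.
Proof.
apply: (@prod_div _ _ F (fun j => (4 * (3 * j + 1))%:R)) => j.
by rewrite mem_index_iota => /andP[_]; apply: den1_unit.
Qed.

Lemma prod_den2 (F : nat -> R) :
  (\prod_(0 <= j < 4 * N) (F j / (4 * (3 * j + 2))%:R)) *
    \prod_(0 <= j < 4 * N) (4 * (3 * j + 2))%:R = \prod_(0 <= j < 4 * N) F j.
Proof.
apply: (@prod_div _ _ F (fun j => (4 * (3 * j + 2))%:R)) => j.
by rewrite mem_index_iota => /andP[_]; apply: den2_unit.
Qed.

Lemma div_1addp x y z : x * (1 + P * y) = z -> x = z * (1 - P * y).
Proof. by move=> <-; rewrite -mulrA -mulrN mul_1addp subrr mulr0 addr0 mulr1. Qed.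

Lemma div_1subp x y z : x * (1 - P * y) = z -> x = z * (1 + P * y).
Proof. by rewrite -mulrN => /div_1addp; rewrite mulrN opprK. Qed.

Lemma hsum_1_expansion : A = C * (1 - P * (s2 / 2%:R)) * (1 + P * ((s1 + s2) / 3%:R)).
Proof.
have := prod_den1 (fun j => (6 * j + 3)%:R); rewrite prod_den1E numA => e.
apply: div_1subp; apply: div_1addp; rewrite -pow2_6N.
apply: (mulrI B1_unit); apply: (mulrI B2_unit); apply: (mulrI pow3N_unit); apply: (mulrI pow3N_unit).
set a := A in e *; set y := _ / 3%:R in e *.
transitivity (u ^+ 2 * (a * (u ^+ 4 * t ^+ 2 * (B1 * B2) * (1 - P * y)))).
  by ring.
rewrite e; transitivity (t ^+ 2 * (C * B1 * B2)); last by ring.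
by rewrite central_bin_blocks B4_duplication; ring.
Qed.

Lemma hsum_2_expansion : B = C * (1 + P * s1) * (1 - P * ((s1 + s2) / 3%:R)).
Proof.
have := prod_den2 (fun j => (6 * j + 5)%:R); rewrite prod_den2E numB => e.
apply: div_1addp; apply: div_1subp.
apply: (mulrI pow2N_unit); apply: (mulrI pow2N_unit); apply: (mulrI pow2N_unit); apply: (mulrI pow2N_unit).
apply: (mulrI B1_unit).
set b := B in e *; set y := _ / 3%:R in e *.
have {}e : b * (u ^+ 4 * B6 * (1 + P * y)) = B2.
  apply: (mulrI pow2N_unit); apply: (mulrI pow2N_unit); apply: (mulrI pow2N_unit); apply: (mulrI pow2N_unit).
  apply: (mulrI pow3N_unit); apply: (mulrI pow3N_unit); apply: (mulrI pow3N_unit); apply: (mulrI pow3N_unit).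
  apply: (mulrI B3_unit); apply: (mulrI B4_unit); apply: (mulrI B5_unit).
  transitivity (b * (u ^+ 8 * t ^+ 4 * (B3 * B4 * (B5 * B6)) * (1 + P * y))).
    by ring.
  by rewrite e; ring.
transitivity (C * B1 * u ^+ 4); last by ring.
rewrite central_bin_B2 -e B6_reflect.
transitivity (eps * eps * (b * u ^+ 4 * B1 * (1 - P * s1) * (1 + P * y))); last by ring.
by rewrite eps_sqr1; ring.
Qed.

(** With x = s2 / 2 and y = (s1 + s2) / 3, A = C (1 + p (y - x)) and B = C (1 + p (s1 - y)). The
    correction in 2 A - B is 3 y - 2 x - s1 = 0. *)
Lemma hsum_value : 2%:R * A - B = C.
Proof.
rewrite hsum_1_expansion hsum_2_expansion.
have e2 := addr_half s2; have e3 : (s1 + s2) / 3%:R *+ 3 = s1 + s2.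
  by rewrite -[LHS]mulr_natr mulrVK.
move: e2 e3; set x := s2 / _; set y := _ / 3%:R => e2 e3.
have -> : s1 = y *+ 3 - (x + x) by rewrite e3 e2 addrK.
rewrite -!(mulrA C) [(1 - _) * _]mulrC !mul_1addp_1subp.
by ring.
Qed.

Lemma hwsum_1_expansion : H * u ^+ 2 * B2 = 2%:R * P * eps * B1.
Proof.
have := prod_den1 (fun j => (6 * j + 7)%:R); rewrite prod_den1E (numH N_gt0) => e.
set y := _ / 3%:R in e; set h := \prod_(0 <= j < 2 * N) _ in e *.
have {}e : h * u ^+ 2 * B2 * (1 - P * y) = P * eps * B1.
  apply: (mulrI pow2N_unit); apply: (mulrI pow2N_unit); apply: (mulrI pow3N_unit); apply: (mulrI pow3N_unit).
  apply: (mulrI B1_unit).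
  transitivity (h * (u ^+ 4 * t ^+ 2 * (B1 * B2) * (1 - P * y))); first by ring.
  by rewrite e; ring.
transitivity (2%:R * (h * u ^+ 2 * B2)); first by ring.
rewrite (div_1subp e).
transitivity (2%:R * eps * B1 * (P * (1 + P * y))); first by ring.
by rewrite p_mul_1addp; ring.
Qed.

Lemma p_mul_pow2_6N : P * u ^+ 6 = P. Proof. by rewrite pow2_6N p_mul_1addp. Qed.

Lemma hwsum_2_expansion : H2 * u ^+ 2 * B2 = 3%:R * P * eps * B1.
Proof.
have := prod_den2 (fun j => (6 * j + 9)%:R); rewrite prod_den2E (numH2 N_gt0) => e.
set y := _ / 3%:R in e; set h := \prod_(0 <= j < 4 * N) _ in e *.
have {}e : h * (u ^+ 4 * (B4 * B5 * B6) * (1 + P * y)) = P * eps * B1 ^+ 2 * B2.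
  apply: (mulrI pow2N_unit); apply: (mulrI pow2N_unit); apply: (mulrI pow2N_unit); apply: (mulrI pow2N_unit).
  apply: (mulrI pow3N_unit); apply: (mulrI pow3N_unit); apply: (mulrI pow3N_unit); apply: (mulrI pow3N_unit).
  apply: (mulrI B3_unit).
  transitivity (h * (u ^+ 8 * t ^+ 4 * (B3 * B4 * (B5 * B6)) * (1 + P * y))).
    by ring.
  by rewrite e; ring.
have {}e : h * u ^+ 8 * B2 = P * eps * B1.
  apply: (mulrI B1_unit); apply: (mulrI B2_unit).
  move: e; rewrite B5_reflect B6_reflect B4_duplication.
  set z := (s2 + s3) / _ => e.
  have {e} : (h * u ^+ 8 * B2 * (B1 * B2)) * (1 + P * (y - z - s2 - s1)) = P * eps * B1 ^+ 2 * B2.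
    rewrite -e -[X in 1 + P * X]addrA -[X in 1 + P * X]addrA -mul_1addp -mul_1addp -mul_1addp !mulrN.
    transitivity (eps * eps * (h * u ^+ 8 * B2 * (B1 * B2) * ((1 + P * y) * ((1 - P * z) * ((1 - P * s2) * (1 - P * s1)))))).
      by rewrite eps_sqr1; ring.
    by ring.
  move=> /div_1addp; set w := (y - z - s2 - s1) => e.
  transitivity (h * u ^+ 8 * B2 * (B1 * B2)); first by ring.
  rewrite e -mulrN.
  transitivity (eps * B1 ^+ 2 * B2 * (P * (1 + P * (- w)))); first by ring.
  by rewrite p_mul_1addp; ring.
apply: (mulrI pow2N_unit); apply: (mulrI pow2N_unit); apply: (mulrI pow2N_unit).
apply: (mulrI pow2N_unit); apply: (mulrI pow2N_unit); apply: (mulrI pow2N_unit).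
transitivity (3%:R * (h * u ^+ 8 * B2)); first by ring.
rewrite e; transitivity (3%:R * eps * B1 * (P * u ^+ 6)); last by ring.
by rewrite p_mul_pow2_6N; ring.
Qed.

(** The expansions of H and H2 differ only in their coefficients 2 and 3, and 2 * 2 - 3 = 1. Then
    [central_bin_B2] trades B1 for B2, and the remaining power 2^(6 N) is 1 modulo p. *)
Lemma hwsum_value : (2%:R * H - H2) * C = P.
Proof.
apply: (mulrI pow2N_unit); apply: (mulrI pow2N_unit); apply: (mulrI B2_unit).
transitivity ((2%:R * (H * u ^+ 2 * B2) - H2 * u ^+ 2 * B2) * C); first by ring.
rewrite hwsum_1_expansion hwsum_2_expansion.
apply: (mulrI pow2N_unit); apply: (mulrI pow2N_unit); apply: (mulrI pow2N_unit); apply: (mulrI pow2N_unit).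
transitivity (P * eps * (C * B1 * u ^+ 4)); first by ring.
rewrite central_bin_B2; transitivity (P * (eps * eps) * B2); first by ring.
rewrite eps_sqr1 mulr1 -{1}p_mul_pow2_6N; ring.
Qed.

End SixN.

(** * Reduction of p-integral rationals *)

(* a is p-integral and r is its image in R, which is to be Z/p^2. *)
Definition rep (a : rat) (r : R) : Prop :=
  exists u : int, exists v : nat,
    [/\ coprime p v, a * v%:R = u%:~R & r * v%:R = u%:~R].

Lemma rep_int (z : int) : rep z%:~R z%:~R.
Proof. by exists z, 1%N; rewrite coprimen1 !mulr1. Qed.

Lemma rep_nat (n : nat) : rep n%:R n%:R.
Proof. exact: (rep_int n). Qed.

Lemma repN a r : rep a r -> rep (- a) (- r).
Proof.
by move=> [u [v [pv e f]]]; exists (- u), v; rewrite !mulNr e f !rmorphN.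
Qed.

Lemma repD a b r s : rep a r -> rep b s -> rep (a + b) (r + s).
Proof.
move=> [u [v [pv e f]]] [u' [v' [pv' e' f']]].
exists (u * v'%:R + u' * v%:R), (v * v')%N; split; first by rewrite coprimeMr pv.
- by rewrite natrM !rmorphD !rmorphM /= -e -e' !rmorph_nat; ring.
- by rewrite natrM !rmorphD !rmorphM /= -f -f' !rmorph_nat; ring.
Qed.

Lemma repM a b r s : rep a r -> rep b s -> rep (a * b) (r * s).
Proof.
move=> [u [v [pv e f]]] [u' [v' [pv' e' f']]].
exists (u * u'), (v * v')%N; split; first by rewrite coprimeMr pv.
- by rewrite natrM !rmorphM /= -e -e' mulrACA.
- by rewrite natrM !rmorphM /= -f -f' mulrACA.
Qed.

Lemma repB a b r s : rep a r -> rep b s -> rep (a - b) (r - s).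
Proof. by move=> ? ?; apply: repD => //; apply: repN. Qed.

Lemma rep_sum (I : Type) (l : seq I) (Q : pred I) (F : I -> rat) (G : I -> R) :
  (forall i, Q i -> rep (F i) (G i)) ->
  rep (\sum_(i <- l | Q i) F i) (\sum_(i <- l | Q i) G i).
Proof.
move=> FG; apply: (big_ind2 rep) => //; first exact: (rep_nat 0).
by move=> *; apply: repD.
Qed.

Lemma rep_prod (I : Type) (l : seq I) (Q : pred I) (F : I -> rat) (G : I -> R) :
  (forall i, Q i -> rep (F i) (G i)) ->
  rep (\prod_(i <- l | Q i) F i) (\prod_(i <- l | Q i) G i).
Proof.
move=> FG; apply: (big_ind2 rep) => //; first exact: (rep_nat 1).
by move=> *; apply: repM.
Qed.

Lemma intr_unit (z : int) : (z%:~R : R) \is a GRing.unit -> coprime p `|z|%N.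
Proof.
move=> zu; rewrite prime_coprime //; apply/negP => /dvdnP[k zk].
have : `|z|%N%:R * P == 0.
  by rewrite -natrM natr_eq0 zk -mulnA dvdn_mull // mulnn.
have zu' : `|z|%N%:R \is a @GRing.unit R by move: zu; case: z {zk} => n //=; rewrite NegzE rmorphN unitrN.
by rewrite mulrI_eq0 ?natr_eq0; [apply/negP; rewrite gtnNdvd ?prime_gt0 //; nia|exact: mulrI].
Qed.

Lemma rep_inv a r : r \is a GRing.unit -> rep a r -> rep a^-1 r^-1.
Proof.
move=> ru [u [v [pv e f]]].
have vu := natr_unit pv.
have uu : u%:~R \is a @GRing.unit R by rewrite -f unitrM ru.
have pu := intr_unit uu.
have e0 : u%:~R != 0 :> rat.
  rewrite intr_eq0; apply/negP => /eqP u0; move: pu.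
  by rewrite u0 prime_coprime // dvdn0.
have a0 : a != 0 by apply: contraNneq e0 => a0; rewrite -e a0 mul0r.
have abs (S : comUnitRingType) : `|u|%N%:R = u%:~R * (sgz u)%:~R :> S.
  by rewrite -intrM mulrC -abszEsg.
exists (v%:R * sgz u), `|u|%N; split => //.
  by rewrite abs -e mulrA mulKf // rmorphM /= rmorph_nat.
by rewrite abs -f mulrA mulKr // rmorphM /= rmorph_nat.
Qed.

Lemma rep_div a b r s : s \is a GRing.unit -> rep a r -> rep b s ->
  rep (a / b) (r / s).
Proof. by move=> su ra sb; apply: repM => //; apply: rep_inv. Qed.

Lemma rep_in_Zloc a r : rep a r -> in_Zloc p a.
Proof.
move=> [u [v [pv e _]]]; rewrite /in_Zloc.
apply: coprime_dvdr pv; rewrite -[v]/(`|v%:Z|%N) -dvdzE.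
have : (denq a %| numq a * v%:Z)%Z.
  apply/dvdzP; exists u; apply: (@intr_inj rat); rewrite !rmorphM /= -e.
  by rewrite -[a in a * _ * _]divq_num_den mulrAC divfK ?intr_eq0 ?denq_neq0.
by rewrite Gauss_dvdzr // coprimezE coprime_sym coprime_num_den.
Qed.

Lemma intr_eq0_dvd (z : int) : z%:~R = 0 :> R -> exists w, z = (p ^ 2)%N%:Z * w.
Proof.
move=> z0; have : ((p ^ 2)%N%:Z %| z)%Z.
  rewrite dvdzE /= -natr_eq0; apply/eqP; move: z0; case: z => n //=.
  by rewrite NegzE rmorphN => /eqP; rewrite oppr_eq0 => /eqP.
by move=> /dvdzP[w ->]; exists w; rewrite mulrC.
Qed.

Lemma in_ZlocP (u : int) (v : nat) : coprime p v -> in_Zloc p (u%:~R / v%:R).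
Proof.
move=> pv; apply: (@rep_in_Zloc _ (u%:~R / v%:R)).
apply: rep_div (rep_int u) (rep_nat v); exact: natr_unit.
Qed.

Lemma coprime_natr_neq0 v : coprime p v -> v%:R != 0 :> rat.
Proof.
by move=> pv; rewrite pnatr_eq0; apply: contraTneq pv => ->; rewrite prime_coprime // dvdn0.
Qed.

Lemma rep_eqmod2 a b r : rep a r -> rep b r -> eqmod_Zloc p 2 a b.
Proof.
move=> ra rb; split; [exact: rep_in_Zloc ra|exact: rep_in_Zloc rb|].
case: ra rb => [u [v [pv e f]]] [u' [v' [pv' e' f']]].
have [w ew] : exists w, u * v'%:Z - u' * v%:Z = (p ^ 2)%N%:Z * w.
  apply: intr_eq0_dvd; rewrite rmorphB !rmorphM /= -f -f' mulrAC subrr //.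
exists (w%:~R / (v * v')%N%:R); first by apply: in_ZlocP; rewrite coprimeMr pv.
have v0 := coprime_natr_neq0 pv; have v0' := coprime_natr_neq0 pv'.
have vv0 : (v * v')%N%:R != 0 :> rat by rewrite natrM mulf_neq0.
apply: (mulIf vv0); rewrite mulrA divfK // -[_%N%:R * _]/((p ^ 2)%N%:Z%:~R * _) -rmorphM -ew.
by rewrite rmorphB !rmorphM /= -e -e'; ring.
Qed.

Lemma rep_eqmod1 a b r s : rep a r -> rep b s -> P * r = P * s ->
  eqmod_Zloc p 1 a b.
Proof.
move=> ra rb rs; split; [exact: rep_in_Zloc ra|exact: rep_in_Zloc rb|].
case: ra rb => [u [v [pv e f]]] [u' [v' [pv' e' f']]].
have [w ew] : exists w, p%:Z * (u * v'%:Z - u' * v%:Z) = (p ^ 2)%N%:Z * w.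
  apply: intr_eq0_dvd; rewrite rmorphM rmorphB !rmorphM /= -f -f'.
  have -> : p%:~R * (r * v%:R * v'%:~R - s * v'%:R * v%:~R) = (P * r - P * s) * (v%:R * v'%:R) :> R by ring.
  by rewrite rs subrr mul0r.
have {}ew : u * v'%:Z - u' * v%:Z = p%:Z * w.
  have p0 : p%:Z != 0 by rewrite eqz_nat -lt0n prime_gt0.
  by apply: (mulfI p0); rewrite ew -mulnn PoszM mulrA.
exists (w%:~R / (v * v')%N%:R); first by apply: in_ZlocP; rewrite coprimeMr pv.
have v0 := coprime_natr_neq0 pv; have v0' := coprime_natr_neq0 pv'.
have vv0 : (v * v')%N%:R != 0 :> rat by rewrite natrM mulf_neq0.
apply: (mulIf vv0); rewrite expn1 mulrA divfK // -[p%:R]/(p%:Z%:~R : rat) -rmorphM -ew.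
by rewrite rmorphB !rmorphM /= -e -e'; ring.
Qed.

(** This transports the closed forms from [rat] to R: the truncated sum and the product are images
    of the same rational. *)
Lemma rep_uniq a r s : rep a r -> rep a s -> r = s.
Proof.
move=> [u [v [pv e f]]] [u' [v' [pv' e' f']]].
have ew : u * v'%:Z = u' * v%:Z.
  by apply: (@intr_inj rat); rewrite !rmorphM /= -e -e' mulrAC.
apply: (mulIr (natr_unit pv)); apply: (mulIr (natr_unit pv')).
by rewrite f mulrAC f'; have := congr1 (fun z : int => z%:~R : R) ew; rewrite !rmorphM.
Qed.

(** * The deformed terms in R and their dependence on s *)

Definition htermR (s : R) (k : nat) : R :=
  \prod_(0 <= i < k)
    (((3 * i)%:R + 1 - s) * ((3 * i)%:R + 2%:R - s) /
       (8%:R * i.+1%:R * (i.+1%:R - s))).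

Lemma sub_p_unit x y : x \is a GRing.unit -> x - P * y \is a GRing.unit.
Proof.
move=> xu; have : (x - P * y) * (x + P * y) \is a GRing.unit.
  have -> : (x - P * y) * (x + P * y) = x * x - P * (P * (y * y)) by ring.
  by rewrite mulrA p_sqr0 mul0r subr0 unitrM xu.
by rewrite unitrM => /andP[].
Qed.

Lemma rep1 : rep 1 1. Proof. exact: (rep_nat 1). Qed.

Lemma unit8 : (8%:R : R) \is a GRing.unit.
Proof. by rewrite -[8%N]/(2 * (2 * 2))%N !natrM !unitrM unit2. Qed.

Lemma rep_hterm (m k : nat) : (k < p)%N ->
  rep (hterm (m * p)%:R k) (htermR (m * p)%:R k).
Proof.
move=> kp; rewrite /hterm /htermR 2![\prod_(_ <= _ < _) _]big_seq_cond.
apply: rep_prod => i; rewrite andbT mem_index_iota => /andP[_ ik].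
apply: rep_div.
- rewrite !unitrM unit8 natr_lt_unit /=; last by lia.
  by rewrite natrM mulrC sub_p_unit // natr_lt_unit //; lia.
- by apply: repM; apply: repB (rep_nat _); apply: repD (rep_nat _) _; [apply: rep1|apply: rep_nat].
- by apply: repM; [apply: repM; apply: rep_nat|apply: repB; apply: rep_nat].
Qed.

(** P^2 = 0 makes a rational function of s = m P affine in m; V is its derivative in s at 0,
    obtained by the product rule along k. *)
Lemma htermR_linear k : (k < p)%N ->
  exists V, forall m : nat, htermR (m * p)%:R k = htermR 0 k + P * m%:R * V.
Proof.
elim: k => [|k IHk] kp.
  by exists 0 => m; rewrite /htermR !big_nil mulr0 addr0.
have [V VE] := IHk (ltnW kp).
have ku : k.+1%:R \is a @GRing.unit R by apply: natr_lt_unit.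
set g := (k.+1%:R : R) in ku *; set a := (3 * k)%:R + 1 : R.
set b := (3 * k)%:R + 2%:R : R; set c := (8%:R * g)^-1.
(* The new ratio (a - s)(b - s) c / (g - s) has value a b c / g and derivative (a b / g - a - b) c /
   g at s = 0. *)
exists (V * (a * b * c / g) +
        htermR 0 k * ((a * b / g - a - b) * c / g)) => m.
have gPV : (g - P * m%:R)^-1 = g^-1 * (1 + P * (m%:R / g)).
  apply: (mulIr (sub_p_unit m%:R ku)); rewrite mulVr ?sub_p_unit //.
  have -> : g^-1 * (1 + P * (m%:R / g)) * (g - P * m%:R) =
      (g^-1 * g) * (1 + P * (m%:R / g)) * (1 - P * (m%:R / g)).
    have -> : g - P * m%:R = g * (1 - P * (m%:R / g)).
      by rewrite mulrBr mulr1 mulrCA [g * (_ / _)]mulrCA mulrV // mulr1.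
    by ring.
  by rewrite mulVr // mul1r mul_1addp_1subp subrr mulr0 addr0.
have HS s : htermR s k.+1 =
    htermR s k * ((a - s) * (b - s) / (8%:R * g * (g - s))).
  by rewrite /htermR big_nat_recr.
rewrite !HS VE natrM [m%:R * P]mulrC.
rewrite [in LHS]invrM ?unitrM ?unit8 ?sub_p_unit // gPV subr0.
have -> : (8%:R * g * (g - 0))^-1 = c / g.
  by rewrite subr0 invrM ?unitrM ?unit8 // mulrC.
rewrite -/c !subr0; set x := m%:R; set T := htermR 0 k; set h := g^-1.
apply/eqP; rewrite -subr_eq0; apply/eqP.
(* The two sides differ by an explicit multiple of P * P, whose cofactor is assembled in [Z]. *)
pose E := 1 - h * (a + b) + P * x * h; pose D := a * b * h - a - b.
pose Z := x * x * (T * E + V * D + P * x * V * E).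
suff -> : (T + P * x * V) * ((a - P * x) * (b - P * x) * (h * (1 + P * (x * h)) * c)) -
   (T * (a * b * (c * h)) + P * x * (V * (a * b * c * h) + T * ((a * b * h - a - b) * c * h))) = P * P * (c * h * Z).
  by rewrite p_sqr0 mul0r.
by rewrite /Z /E /D; ring.
Qed.

Lemma p_mul_htermR m k : (k < p)%N -> P * htermR (m * p)%:R k = P * htermR 0 k.
Proof.
move=> kp; have [V ->] := htermR_linear kp.
by rewrite mulrDr !mulrA p_sqr0 !mul0r addr0.
Qed.

Definition hsumR m : R := \sum_(0 <= k < p) htermR (m * p)%:R k.
Definition hwsumR m : R :=
  \sum_(0 <= k < p) (k%:R + 1 + (m * p)%:R) * htermR (m * p)%:R k.

Lemma hsumR_linear : hsumR 0 = 2%:R * hsumR 1 - hsumR 2.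
Proof.
rewrite /hsumR mulr_sumr -sumrB; apply: eq_big_seq => k.
rewrite mem_index_iota => /andP[_ kp]; have [V VE] := htermR_linear kp.
by rewrite !VE; ring.
Qed.

Lemma hwsumR_linear : hwsumR 0 = 2%:R * hwsumR 1 - hwsumR 2.
Proof.
rewrite /hwsumR mulr_sumr -sumrB; apply: eq_big_seq => k.
rewrite mem_index_iota => /andP[_ kp]; have [V VE] := htermR_linear kp.
have e m : (k%:R + 1 + (m * p)%:R) * htermR (m * p)%:R k =
    (k%:R + 1) * htermR (m * p)%:R k + m%:R * (P * htermR 0 k).
  by rewrite -(p_mul_htermR m kp); set T := htermR _ _; rewrite natrM; ring.
by rewrite !e !VE; ring.
Qed.

Lemma p_mul_hsumR m : P * hsumR m = P * hsumR 0.
Proof.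
rewrite !mulr_sumr; apply: eq_big_seq => k.
by rewrite mem_index_iota => /andP[_ kp]; rewrite p_mul_htermR // (p_mul_htermR 0).
Qed.

Lemma p_mul_hwsumR m : P * hwsumR m = P * hwsumR 0.
Proof.
rewrite !mulr_sumr; apply: eq_big_seq => k.
rewrite mem_index_iota => /andP[_ kp]; rewrite ![P * (_ * _)]mulrCA.
rewrite p_mul_htermR // (p_mul_htermR 0) // mulrA [RHS]mulrA; congr (_ * _).
by rewrite !mulrDl !natrM -!mulrA p_sqr0 !mulr0.
Qed.

Lemma p_mod3 : ~~ (3 %| p)%N.
Proof. by rewrite dvdn_prime2 //; apply/eqP; move: p_gt3; lia. Qed.

(** For m < 3 the terms of index at least p vanish, since m p <= 3 p, so the sum up to m p is the
    sum up to p. All denominators met below index p are units. *)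
Lemma rep_hsum m : (0 < m < 3)%N -> rep (hsum (m * p)) (hsumR m).
Proof.
move=> m3; have m3p : ~~ (3 %| m * p)%N by move: p_mod3; case: m m3 => [|[|[|]]] //; lia.
have -> : hsum (m * p) = \sum_(0 <= k < p) hterm (m * p)%:R k.
  transitivity (\sum_(0 <= k < m * p) 1 * hterm (m * p)%:R k).
    by apply: eq_bigr => k _; rewrite mul1r.
  rewrite (@hterm_sum_trunc (fun=> 1) (m * p) p) //; [|nia..].
  by apply: eq_bigr => k _; rewrite mul1r.
rewrite /hsumR big_seq_cond [X in rep _ X]big_seq_cond; apply: rep_sum => k.
by rewrite andbT mem_index_iota => /andP[_ kp]; apply: rep_hterm.
Qed.

Lemma rep_hwsum m : (0 < m < 3)%N -> rep (hwsum (m * p)) (hwsumR m).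
Proof.
move=> m3; have m3p : ~~ (3 %| m * p)%N by move: p_mod3; case: m m3 => [|[|[|]]] //; lia.
rewrite /hwsum (@hterm_sum_trunc (fun k => k%:R + 1 + (m * p)%:R) (m * p) p) //; [|nia..].
rewrite /hwsumR big_seq_cond [X in rep _ X]big_seq_cond; apply: rep_sum => k.
rewrite andbT mem_index_iota => /andP[_ kp]; apply: repM; last exact: rep_hterm.
by apply: repD (rep_nat _); apply: repD (rep_nat _) rep1.
Qed.

Lemma rep_prod_ratio (l : seq nat) (F G : nat -> nat) :
  {in l, forall j, coprime p (G j)} ->
  rep (\prod_(j <- l) ((F j)%:R / (G j)%:R)) (\prod_(j <- l) ((F j)%:R / (G j)%:R)).
Proof.
move=> pG; rewrite big_seq_cond [X in rep _ X]big_seq_cond; apply: rep_prod => j.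
by rewrite andbT => /pG /natr_unit Gu; apply: rep_div Gu (rep_nat _) (rep_nat _).
Qed.

Lemma natr_unit_coprime a : (a%:R : R) \is a GRing.unit -> coprime p a.
Proof. exact: (@intr_unit a). Qed.

(** * The two sums at s = 0 for p = 1 modulo 3 *)

Section SumsOneModThree.

Variable N : nat.
Hypothesis pN : p = (6 * N + 1)%N.
Local Notation C := ('C(2 * (2 * N), 2 * N)%:R : R).

Lemma rep_ratio1 (F : nat -> nat) :
  rep (\prod_(0 <= j < 2 * N) ((F j)%:R / (4 * (3 * j + 1))%:R))
      (\prod_(0 <= j < 2 * N) ((F j)%:R / (4 * (3 * j + 1))%:R)).
Proof.
apply: (@rep_prod_ratio _ F (fun j => 4 * (3 * j + 1))%N) => j.
rewrite mem_index_iota => /andP[_ jN].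
by apply: natr_unit_coprime; apply: (@den1_unit N).
Qed.

Lemma rep_ratio2 (F : nat -> nat) :
  rep (\prod_(0 <= j < 4 * N) ((F j)%:R / (4 * (3 * j + 2))%:R))
      (\prod_(0 <= j < 4 * N) ((F j)%:R / (4 * (3 * j + 2))%:R)).
Proof.
apply: (@rep_prod_ratio _ F (fun j => 4 * (3 * j + 2))%N) => j.
rewrite mem_index_iota => /andP[_ jN].
by apply: natr_unit_coprime; apply: (@den2_unit N).
Qed.

Lemma hsumR0_1mod3 : hsumR 0 = C.
Proof.
rewrite hsumR_linear -(hsum_value pN); congr (_ * _ - _).
  apply: (@rep_uniq (hsum (1 * p))); first exact: rep_hsum.
  have -> : (1 * p = 3 * (2 * N) + 1)%N by lia.
  by rewrite hsum_3n1; apply: rep_ratio1.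
apply: (@rep_uniq (hsum (2 * p))); first exact: rep_hsum.
have -> : (2 * p = 3 * (4 * N) + 2)%N by lia.
by rewrite hsum_3n2; apply: rep_ratio2.
Qed.

Lemma hwsumR0_1mod3 : hwsumR 0 * C = P.
Proof.
rewrite -[RHS](hwsum_value pN) hwsumR_linear; congr ((_ * _ - _) * _).
  apply: (@rep_uniq (hwsum (1 * p))); first exact: rep_hwsum.
  have -> : (1 * p = 3 * (2 * N) + 1)%N by lia.
  by rewrite hwsum_3n1; apply: repM (rep_nat _) _; apply: rep_ratio1.
apply: (@rep_uniq (hwsum (2 * p))); first exact: rep_hwsum.
have -> : (2 * p = 3 * (4 * N) + 2)%N by lia.
by rewrite hwsum_3n2; apply: repM (rep_nat _) _; apply: rep_ratio2.
Qed.

Lemma central_bin_unit : C \is a GRing.unit.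
Proof.
have := central_bin_blocks pN; have := B1_unit pN; have := B2_unit pN; have := B3_unit pN; have := B4_unit pN.
move=> u4 u3' u2' u1 e; have : C * range_prod 0 N * range_prod N (2 * N) \is a GRing.unit.
  by rewrite e unitrM u3'.
by rewrite !unitrM => /andP[/andP[]].
Qed.

End SumsOneModThree.

(** * The two sums modulo p for p = 2 modulo 3 *)

Section SumsTwoModThree.

Variable m : nat.
Hypothesis pm : p = (3 * m + 2)%N.

Lemma m_odd : odd m.
Proof.
have /even_prime [p2|] := p_prime.
  by move: p_gt3; rewrite p2.
by rewrite pm oddD oddM /= addbF.
Qed.

Lemma den_2mod3_unit j : (j < m)%N -> (4 * (3 * j + 2))%:R \is a @GRing.unit R.
Proof. by move=> jm; rewrite natrM unitrM unit4 natr_lt_unit //; lia. Qed.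

Lemma rep_ratio_2mod3 (F : nat -> nat) :
  rep (\prod_(0 <= j < m) ((F j)%:R / (4 * (3 * j + 2))%:R))
      (\prod_(0 <= j < m) ((F j)%:R / (4 * (3 * j + 2))%:R)).
Proof.
apply: (@rep_prod_ratio _ F (fun j => 4 * (3 * j + 2))%N) => j.
rewrite mem_index_iota => /andP[_ jN].
by apply: natr_unit_coprime; apply: den_2mod3_unit.
Qed.

(** Modulo p the value at s = p suffices. As m is odd, the numerator 6 j + 5 at j = (m - 1) / 2 is
    p. *)
Lemma p_mul_hsumR0_2mod3 : P * hsumR 0 = 0.
Proof.
rewrite -(p_mul_hsumR 1).
have -> : hsumR 1 = \prod_(0 <= j < m) ((6 * j + 5)%:R / (4 * (3 * j + 2))%:R).
  apply: (@rep_uniq (hsum (1 * p))); first exact: rep_hsum.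
  by rewrite mul1n pm hsum_3n2; apply: rep_ratio_2mod3.
have mo := m_odd; have m2 := odd_double_half m; rewrite mo in m2.
rewrite (bigD1_seq m./2) ?iota_uniq ?mem_index_iota //=; last by lia.
have -> : (6 * m./2 + 5 = p)%N by lia.
by rewrite !mulrA p_sqr0 !mul0r.
Qed.

(** Modulo p, the denominators 4 (3 j + 2) = 4 p - 12 i give (-12)^m m!, and the numerators are 3
    times the odd numbers 3, ..., 2 m + 1, whose product the central binomial also contains. What
    remains is 2^(3 m + 1) = 2^(p - 1) and 3 (m + 1) = p + 1, both 1 modulo p; the sign is (-1)^m
    with m odd. *)
Lemma p_mul_hwsumR0_2mod3 : P * hwsumR 0 = - (P * 'C(2 * m.+1, m.+1)%:R).
Proof.
rewrite -(p_mul_hwsumR 1).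
have -> : hwsumR 1 = 3%:R * \prod_(0 <= j < m) ((6 * j + 9)%:R / (4 * (3 * j + 2))%:R).
  apply: (@rep_uniq (hwsum (1 * p))); first exact: rep_hwsum.
  by rewrite mul1n pm hwsum_3n2; apply: repM (rep_nat _) _; apply: rep_ratio_2mod3.
have : \prod_(0 <= j < m) ((6 * j + 9)%:R / (4 * (3 * j + 2))%:R) *
   \prod_(0 <= j < m) (4 * (3 * j + 2))%:R = \prod_(0 <= j < m) (6 * j + 9)%:R :> R.
  apply: (@prod_div _ _ (fun j => (6 * j + 9)%:R) (fun j => (4 * (3 * j + 2))%:R)) => j.
  by rewrite mem_index_iota => /andP[_]; apply: den_2mod3_unit.
rewrite (@prod_AP_down (fun j => (4 * (3 * j + 2))%:R) 0 m (- 12%:R) 4%:R) ?unitrN ?unit12 //; last 2 first.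
- by lia.
- move=> i iM; rewrite mulNr -!natrM addrC; apply/eqP.
  by rewrite eq_sym subr_eq -natrD; apply/eqP; congr (_%:R); lia.
set h := \prod_(0 <= j < m) (_ / _); rewrite add0n; set y := _ / _ * _.
have -> : \prod_(0 <= j < m) (6 * j + 9)%:R =
    3%:R ^+ m * \prod_(0 <= j < m.+1) (2 * j + 1)%:R :> R.
  rewrite [in RHS]big_nat_recl //= mul1r.
  rewrite -[m in 3%:R ^+ m]subn0 -prodr_const_nat -big_split /=.
  by apply: eq_bigr => j _; rewrite -natrM; congr (_%:R); lia.
have := prod_even_odd m.+1; rewrite -[\prod_(1 <= i < _) _]/(range_prod 0 (2 * m.+1)).
set d := \prod_(0 <= j < m.+1) _ => e1 e2.
have {}e1 : 'C(2 * m.+1, m.+1)%:R * range_prod 0 m.+1 = 2%:R ^+ m.+1 * d.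
  have bu : range_prod 0 m.+1 \is a GRing.unit by apply: range_prod_unit; lia.
  apply: (mulrI bu).
  transitivity (range_prod 0 (2 * m.+1)); last by rewrite e1; ring.
  rewrite !range_prod_fact -!natrM; congr (_%:R).
  have := @bin_fact (2 * m.+1) m.+1; have -> : (2 * m.+1 - m.+1 = m.+1)%N by lia.
  by rewrite mulnCA => ->; lia.
have {}e2 : P * h * (- 12%:R) ^+ m * range_prod 0 m = P * 3%:R ^+ m * d.
  rewrite -[RHS]mulrA -e2.
  transitivity (h * (- 12%:R) ^+ m * range_prod 0 m * (P * (1 + P * y))); last by ring.
  by rewrite p_mul_1addp; ring.
have bu : range_prod 0 m \is a GRing.unit by apply: range_prod_unit; lia.
have t3 : (3%:R ^+ m : R) \is a GRing.unit by apply: unitrX.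
have t2 : (2%:R ^+ m.+1 : R) \is a GRing.unit by apply: unitrX.
have e12 : (- 12%:R) ^+ m = - (2%:R ^+ (2 * m) * 3%:R ^+ m) :> R.
  rewrite exprNn -signr_odd m_odd expr1 mulN1r exprM -exprMn; congr (- (_ ^+ _)).
  by ring.
rewrite e12 in e2.
have f2 : P * 2%:R ^+ p.-1 = P.
  by apply: p_mul_fermat; rewrite coprimen2 pm oddD oddM /= m_odd.
have e3 : range_prod 0 m.+1 = range_prod 0 m * m.+1%:R by rewrite range_prod_last.
apply: (mulrI t3); apply: (mulrI bu).
have n3 : P * 3%:R * m.+1%:R = P.
  rewrite -mulrA -natrM -[RHS]mulr1; apply: (@p_mul_modp _ 1).
  have -> : (3 * m.+1 = p + 1)%N by lia.
  by rewrite modnDl.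
apply: oppr_inj.
transitivity (3%:R * (P * h * - (2%:R ^+ (2 * m) * 3%:R ^+ m) * range_prod 0 m) * 2%:R ^+ m.+1).
  have pE : p.-1 = (2 * m + m.+1)%N by lia.
  rewrite -{1}f2 pE exprD; ring.
rewrite e2; transitivity (3%:R ^+ m * P * 3%:R * (2%:R ^+ m.+1 * d)); first by ring.
rewrite -e1 e3.
transitivity (3%:R ^+ m * range_prod 0 m * 'C(2 * m.+1, m.+1)%:R * (P * 3%:R * m.+1%:R)); first by ring.
by rewrite n3; ring.
Qed.

End SumsTwoModThree.

(** * The Jacobi sum *)

Section Teichmuller.

Local Notation F := 'F_p.

Lemma exp_add_p x z k : (x + P * z) ^+ k.+1 = x ^+ k.+1 + P * (k.+1%:R * x ^+ k * z).
Proof.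
elim: k => [|k IHk]; first by rewrite !expr1 expr0 !mul1r.
rewrite exprS IHk (exprS _ k.+1).
set q := k.+1; rewrite -(natr1 q) /q exprS.
have -> : (x + P * z) * (x * x ^+ k + P * (k.+1%:R * x ^+ k * z)) =
   x * (x * x ^+ k) + P * ((k.+1%:R + 1) * (x * x ^+ k) * z) +
   P * P * (z * (k.+1%:R * x ^+ k * z)) by ring.
by rewrite p_sqr0 mul0r addr0.
Qed.

Lemma exp_p_add_p x z : (x + P * z) ^+ p = x ^+ p.
Proof.
have := exp_add_p x z p.-1; rewrite prednK ?prime_gt0 // => ->.
by rewrite !mulrA p_sqr0 !mul0r addr0.
Qed.

(** One p-th power is enough for the Teichmueller lift: modulo p^2 it depends only on the class of
    its base modulo p. *)
Definition tau (t : F) : R := (t : nat)%:R ^+ p.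

Lemma tau_natr a : tau a%:R = a%:R ^+ p.
Proof.
rewrite /tau val_Fp_nat //.
have -> : a%:R = (a %% p)%:R + P * (a %/ p)%:R :> R.
  by rewrite -natrM -natrD addnC mulnC -divn_eq.
by rewrite exp_p_add_p.
Qed.

Lemma natr_Fp (t : F) : t = (t : nat)%:R.
Proof. by rewrite natr_Zp. Qed.

Lemma tau1 : tau 1 = 1.
Proof. by rewrite (tau_natr 1) expr1n. Qed.

Lemma tau0 : tau 0 = 0.
Proof. by rewrite (tau_natr 0) expr0n eqn0Ngt prime_gt0. Qed.

Lemma tauM s t : tau (s * t) = tau s * tau t.
Proof.
by rewrite [s]natr_Fp [t]natr_Fp -natrM !tau_natr natrM exprMn.
Qed.

Lemma tauX t k : tau (t ^+ k) = tau t ^+ k.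
Proof.
by elim: k => [|k IHk]; rewrite ?expr0 ?tau1 // !exprS tauM IHk.
Qed.

Lemma Fp_exp_p (t : F) : t ^+ p = t.
Proof.
rewrite [t]natr_Fp -natrX -(Fp_nat_mod p_prime) -[RHS](Fp_nat_mod p_prime).
by rewrite fermat_little.
Qed.

Lemma Fp_exp_pred (t : F) : t != 0 -> t ^+ p.-1 = 1.
Proof.
move=> t0; apply: (mulfI t0).
by rewrite -exprS prednK ?prime_gt0 // Fp_exp_p mulr1.
Qed.

Lemma tau_exp_p t : tau t ^+ p = tau t.
Proof. by rewrite -tauX Fp_exp_p. Qed.

Lemma dvdn_Fp a : (p %| a)%N = ((a%:R : F) == 0).
Proof. by rewrite -val_eqE /= val_Fp_nat. Qed.

(** R has zero divisors, so cancelling tau t - 1 in the orthogonality arguments takes a unit; it is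
    one because its reduction t - 1 is nonzero. *)
Lemma tau_sub1_unit t : t != 1 -> tau t - 1 \is a GRing.unit.
Proof.
move=> t1; have [->|t0] := eqVneq t 0.
  by rewrite tau0 sub0r unitrN unitr1.
have tn0 : (0 < (t : nat) ^ p)%N.
  by rewrite expn_gt0 lt0n; apply/orP; left; apply: contraNneq t0 => e; rewrite [t]natr_Fp e.
rewrite /tau -natrX -[1]/(1%:R) -natrB //; apply: natr_unit.
rewrite prime_coprime // dvdn_Fp natrB // natrX -natr_Fp Fp_exp_p.
by rewrite subr_eq0.
Qed.

(** Otherwise all p - 1 nonzero elements would be roots of X^r - 1 for the remainder r of e, with 0
    < r < p - 1. This takes the place of a primitive root. *)
Lemma exists_nonroot e : ~~ (p.-1 %| e)%N -> exists2 g : F, g != 0 & g ^+ e != 1.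
Proof.
move=> pe; have e0 : (0 < e %% p.-1)%N by rewrite lt0n.
have [g /andP[g0 ge]|noroot] := pickP [pred g : F | (g != 0) && (g ^+ e != 1)].
  by exists g.
have le : (size [seq g <- enum F | (g != 0)%R] <= e %% p.-1)%N.
  apply: max_unity_roots => //; last by rewrite filter_uniq ?enum_uniq.
  apply/allP => g; rewrite mem_filter => /andP[g0 _].
  apply/unity_rootP; have := noroot g; rewrite /= g0 => /negbFE/eqP ge.
  rewrite -ge [in RHS](divn_eq e p.-1) exprD mulnC exprM.
  by rewrite Fp_exp_pred // expr1n mul1r.
have : (p.-1 <= e %% p.-1)%N.
  apply: leq_trans le; rewrite -[in X in (X <= _)%N](card_Fp p_prime) -(cardC1 (0 : F)).
  rewrite cardE; apply: uniq_leq_size; first exact: enum_uniq.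
  by move=> x; rewrite mem_enum inE => x0; rewrite mem_filter x0 mem_enum.
have p1 : (0 < p.-1)%N by lia.
by rewrite leqNgt ltn_mod p1.
Qed.

Lemma sum_tau e : (0 < e)%N ->
  \sum_(t : F) tau t ^+ e = (p.-1 %| e)%N%:R * (P - 1).
Proof.
move=> e0; have [/dvdnP[k ek]|ne] := boolP (p.-1 %| e)%N.
  rewrite mul1r (bigD1 0) //= tau0 expr0n eqn0Ngt e0 add0r.
  rewrite (eq_bigr (fun=> 1)) => [|t t0]; last first.
    by rewrite ek mulnC exprM -tauX Fp_exp_pred // tau1 expr1n.
  rewrite sumr_const; have -> : #|(fun t : F => t != 0)| = p.-1.
    by rewrite -[in RHS](card_Fp p_prime) -(cardC1 (0 : F)); apply: eq_card.
  by rewrite -subn1 natrB ?prime_gt0.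
rewrite mul0r; have [g g0 ge] := exists_nonroot ne.
have gu := tau_sub1_unit ge; apply: (mulrI gu).
rewrite mulr0 mulrBl mul1r; apply/eqP; rewrite subr_eq0; apply/eqP.
have gI : bijective ( *%R g).
  by exists ( *%R g^-1) => x; rewrite ?mulKf ?mulVKf.
rewrite [RHS](reindex ( *%R g)) /=; last exact: onW_bij.
by rewrite mulr_sumr; apply: eq_bigr => t _; rewrite tauX tauM exprMn.
Qed.

End Teichmuller.

(** * Jacobi sums of the cubic character for p = 1 modulo 3 *)

Section JacobiSum.

Local Notation F := 'F_p.
Variable N : nat.
Hypothesis pN : p = (6 * N + 1)%N.
Local Notation n := (2 * N)%N.
Local Notation C := ('C(2 * n, n)%:R : R).

Lemma p_odd : odd p.
Proof. by rewrite pN oddD oddM. Qed.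

Lemma p_mul_bin_pred j : (j < p)%N -> P * 'C(p.-1, j)%:R = P * (-1) ^+ j.
Proof.
elim: j => [|j IHj] jp; first by rewrite bin0 expr0.
have := binS p.-1 j; rewrite prednK ?prime_gt0 // => e.
have : P * 'C(p, j.+1)%:R == 0 by rewrite p_mul_eq0 prime_dvd_bin.
rewrite e natrD mulrDr IHj 1?ltnW // exprS addr_eq0 => /eqP ->.
by rewrite mulN1r mulrN.
Qed.

Lemma bin_p i : (0 < i < p)%N -> 'C(p, i)%:R = P * ((-1) ^+ i.-1 / i%:R) :> R.
Proof.
case: i => // i ip; have iu : i.+1%:R \is a @GRing.unit R by apply: natr_lt_unit.
apply: (mulIr iu); rewrite mulrA mulrVK // -p_mul_bin_pred; last by lia.
by rewrite -!natrM; congr (_%:R); rewrite mulnC -mul_bin_diag.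
Qed.

Lemma natr_modp a b : a = b %[mod p] -> exists z, a%:R = b%:R + P * z :> R.
Proof.
move=> ab; exists ((a %/ p)%:R - (b %/ p)%:R).
rewrite {1}(divn_eq a p) {1}(divn_eq b p) ab !natrD !natrM; ring.
Qed.

(** 1 - tau t is a lift of 1 - t, and the p-th power does not depend on the lift. *)
Lemma tau_1sub (t : F) : tau (1 - t) = (1 - tau t) ^+ p.
Proof.
rewrite [t]natr_Fp; set v := nat_of_ord t.
have vp : (v < p)%N by rewrite -[X in (_ < X)%N](Fp_cast p_prime); apply: ltn_ord.
have -> : 1 - v%:R = (p + 1 - v)%N%:R :> F.
  by rewrite natrB ?natrD ?(pchar_Fp_0 p_prime) ?add0r //; lia.
rewrite !tau_natr; have -> : (p + 1 - v)%N%:R = (1 - v%:R) + P * 1 :> R.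
  by rewrite natrB ?natrD; [ring|lia].
have [z] := natr_modp (fermat_little v p_prime); rewrite natrX => ->.
have -> : 1 - (v%:R + P * z) = 1 - v%:R + P * (- z) by ring.
by rewrite !exp_p_add_p.
Qed.

(* (1 - x)^p = 1 - x^p - p * logpoly x for odd p, as p^2 = 0. *)
Definition logpoly (x : R) : R := \sum_(1 <= i < p) x ^+ i / i%:R.

Lemma tau_1sub_log (t : F) : tau (1 - t) = 1 - tau t + P * (- logpoly (tau t)).
Proof.
rewrite tau_1sub; set x := tau t.
rewrite exprDn -(big_mkord xpredT (fun i => 1 ^+ (p - i) * (- x) ^+ i *+ 'C(p, i))).
rewrite big_nat_recr //= binn big_ltn ?prime_gt0 // bin0 expr0 !expr1n !mulr1n !mul1r.
rewrite exprNn -signr_odd p_odd expr1 mulN1r tau_exp_p -addrA [X in _ + X]addrC addrA.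
congr (_ + _); rewrite mulrN mulr_sumr -sumrN; apply: eq_big_seq => i.
rewrite mem_index_iota => ip; rewrite expr1n mul1r -mulr_natr bin_p //.
case: i ip => // i ip; rewrite (exprNn x) /=.
have -> : (-1) ^+ i.+1 * x ^+ i.+1 * (P * ((-1) ^+ i / i.+1%:R)) =
   - (((-1) ^+ i * (-1) ^+ i) * (P * (x ^+ i.+1 / i.+1%:R))) by rewrite exprS; ring.
by rewrite -exprMn mulrNN mulr1 expr1n mul1r.
Qed.

Lemma p_mul_sum_tau e : (0 < e)%N ->
  P * \sum_(t : F) tau t ^+ e = - (P * (3 * n %| e)%N%:R).
Proof.
move=> e0; rewrite sum_tau //; have -> : p.-1 = (3 * n)%N by lia.
by rewrite mulrCA mulrBr p_sqr0 mulr1 sub0r; ring.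
Qed.

(** The sum U of the overview, with 2 n = 2 (p - 1) / 3; it belongs to the square of the cubic
    character. *)
Definition jac2 : R := \sum_(t : F) tau t ^+ (2 * n) * tau (1 - t) ^+ (2 * n).

Lemma jac2_main :
  \sum_(t : F) tau t ^+ (2 * n) * (1 - tau t) ^+ (2 * n) = (P - 1) * C.
Proof.
transitivity (\sum_(0 <= j < (2 * n).+1) (-1) ^+ j * 'C(2 * n, j)%:R *
    (\sum_(t : F) tau t ^+ (2 * n + j))).
  under [RHS]eq_bigr do rewrite mulr_sumr.
  rewrite exchange_big /=; apply: eq_bigr => t _.
  rewrite exprDn -(big_mkord xpredT (fun i => 1 ^+ (2 * n - i) * (- tau t) ^+ i *+ 'C(2 * n, i))).
  rewrite mulr_sumr; apply: eq_bigr => j _.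
  by rewrite expr1n mul1r (exprNn (tau t)) exprD -mulr_natr; ring.
have n0 : (0 < N)%N by apply: N_gt0.
(* For 0 <= j <= 2 n, the exponent 2 n + j is a multiple of p - 1 = 3 n only at j = n. *)
rewrite (bigD1_seq n) ?iota_uniq ?mem_index_iota //=; last by lia.
rewrite [X in _ + X]big1_seq ?addr0 => [|j /andP[jn]]; last first.
  rewrite mem_index_iota => /andP[_ jl]; rewrite sum_tau; last by lia.
  suff -> : (p.-1 %| 2 * n + j)%N = false by rewrite mul0r mulr0.
  apply/negP => /dvdnP[k]; have -> : p.-1 = (6 * N)%N by lia.
  case: k => [|[|k]]; [lia|move: jn; lia|nia].
rewrite sum_tau; last by lia.
have -> : (p.-1 %| 2 * n + n)%N.
  by have -> : p.-1 = (2 * n + n)%N by lia.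
have -> : (-1) ^+ n = 1 :> R by rewrite exprM sqrrN !expr1n.
by rewrite !mul1r mulrC.
Qed.

(* The unique exponent 0 < i < p with 3n | 2n + i + j is n - j or 4n - j. *)
Lemma logpoly_pick j : (j < 2 * n)%N ->
  P * \sum_(1 <= i < p) i%:R^-1 * (3 * n %| 2 * n + j + i)%N%:R =
  if (j < n)%N then P * (n - j)%:R^-1 else - (P * (j.+1 - n)%:R^-1).
Proof.
move=> jn; have n0 : (0 < N)%N by apply: N_gt0.
pose i0 := (if j < n then n - j else 4 * n - j)%N.
have i0p : (0 < i0 < p)%N by rewrite /i0; case: ifP; lia.
rewrite (bigD1_seq i0) ?iota_uniq ?mem_index_iota //=.
rewrite [X in _ + X]big1_seq ?addr0 => [|i /andP[ii0]]; last first.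
  rewrite mem_index_iota => /andP[i1 ip].
  suff -> : (3 * n %| 2 * n + j + i)%N = false by rewrite mulr0.
  apply/negP => /dvdnP[k e]; move/negP: ii0; apply; apply/eqP.
  by move: e; rewrite /i0; case: ifP => h; case: k => [|[|[|k]]]; nia.
have -> : (3 * n %| 2 * n + j + i0)%N.
  rewrite /i0; case: ifP => h; apply/dvdnP; [exists 1%N|exists 2]; lia.
rewrite mulr1 /i0; case: ifP => h //.
have u1 : (4 * n - j)%N%:R \is a @GRing.unit R by apply: natr_lt_unit; lia.
have u2' : (j.+1 - n)%N%:R \is a @GRing.unit R by apply: natr_lt_unit; lia.
apply: (mulIr u1); rewrite mulrVK //; apply: (mulIr u2').
have -> : (4 * n - j)%N%:R = P - (j.+1 - n)%N%:R :> R.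
  by apply/eqP; rewrite eq_sym subr_eq -natrD; apply/eqP; congr (_%:R); lia.
set y := (j.+1 - n)%N%:R in u2' *.
transitivity (P * (y^-1 * y) * y - P * P * (y^-1 * y)); last by ring.
by rewrite p_sqr0 mul0r subr0 mulVr // mulr1.
Qed.

(** Expand (1 - x)^(2 n - 1) in powers x^j and [logpoly] in powers x^i. Orthogonality modulo p
    leaves a single i for each j, found by [logpoly_pick]. *)
Lemma jac2_correction :
  P * \sum_(t : F) tau t ^+ (2 * n) *
      ((2 * n)%:R * (1 - tau t) ^+ (2 * n).-1 * (- logpoly (tau t))) =
  - (P * \sum_(1 <= d < n.+1)
     (-1) ^+ d.-1 * (2 * (n + d) * 'C(2 * n, n - d))%:R / d%:R).
Proof.
have n0 : (0 < N)%N by apply: N_gt0.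
pose G j : R := \sum_(1 <= i < p) i%:R^-1 * (3 * n %| 2 * n + j + i)%N%:R.
pose c j : R := (2 * n)%:R * ((-1) ^+ j * 'C((2 * n).-1, j)%:R).
have binE x : (2 * n)%:R * (1 - x) ^+ (2 * n).-1 = \sum_(0 <= j < 2 * n) c j * x ^+ j.
  rewrite exprDn -(big_mkord xpredT (fun i => 1 ^+ ((2 * n).-1 - i) * (- x) ^+ i *+ 'C((2 * n).-1, i))).
  rewrite prednK; last by lia.
  rewrite mulr_sumr; apply: eq_bigr => j _.
  by rewrite expr1n mul1r (exprNn x) -[in LHS]mulr_natr /c; ring.
transitivity (\sum_(t : F) \sum_(0 <= j < 2 * n) \sum_(1 <= i < p)
    (- (c j * i%:R^-1)) * (P * tau t ^+ (2 * n + j + i))).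
  rewrite mulr_sumr; apply: eq_bigr => t _; rewrite binE; set x := tau t.
  transitivity (\sum_(0 <= j < 2 * n) c j * x ^+ j * (- (P * x ^+ (2 * n) * logpoly x))).
    by rewrite -mulr_suml; ring.
  apply: eq_bigr => j _; rewrite /logpoly -mulrN -sumrN !mulr_sumr.
  by apply: eq_bigr => i _; rewrite !exprD; ring.
rewrite exchange_big /=.
transitivity (\sum_(0 <= j < 2 * n) c j * (P * G j)).
  apply: eq_bigr => j _; rewrite exchange_big /= /G 2!mulr_sumr.
  apply: eq_big_seq => i; rewrite mem_index_iota => /andP[i1 _].
  rewrite -2!mulr_sumr p_mul_sum_tau; last by lia.
  by ring.
transitivity (\sum_(0 <= j < n) c j * (P * (n - j)%:R^-1) +
              \sum_(0 <= j < n) c j * (P * (n - j)%:R^-1)).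
  rewrite (@big_cat_nat _ _ _ n) /=; [|lia..]; congr (_ + _).
    apply: eq_big_seq => j; rewrite mem_index_iota => /andP[_ jn].
    by rewrite logpoly_pick ?jn //; lia.
  (* The indices j and 2 n - 1 - j have opposite parity, and the opposite sign in [logpoly_pick]
     makes their contributions equal. *)
  rewrite (@big_nat_reindex _ _ _ (fun j => (2 * n).-1 - j)%N 0 n); [|lia..|by move=> ? ?; rewrite !inE; lia].
  apply: eq_big_seq => j; rewrite mem_index_iota => /andP[_ jn].
  rewrite logpoly_pick; last by lia.
  have -> : ((2 * n).-1 - j < n)%N = false by lia.
  have -> : (((2 * n).-1 - j).+1 - n = n - j)%N by lia.
  rewrite mulrN -mulNr; congr (_ * _); rewrite /c bin_sub; last by lia.
  rewrite -mulrN -mulNr -[in RHS]signr_odd -[in LHS]signr_odd.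
  have -> : odd ((2 * n).-1 - j) = ~~ odd j by lia.
  by case: odd; rewrite /= ?expr0 ?expr1 ?opprK.
rewrite -big_split /= mulr_sumr -sumrN.
rewrite (@big_nat_reindex _ _ _ (fun d => n - d)%N 1 n.+1); [|lia..|by move=> ? ?; rewrite !inE; lia].
apply: eq_big_seq => d; rewrite mem_index_iota => /andP[d1 dn].
have -> : (n - (n - d) = d)%N by lia.
have e : ((2 * n) * 'C((2 * n).-1, n - d) = (n + d) * 'C(2 * n, n - d))%N.
  have := mul_bin_down (2 * n) (n - d).
  by have -> : (2 * n - (n - d) = n + d)%N by lia.
have {}e : (2 * n)%:R * 'C((2 * n).-1, n - d)%:R = (n + d)%:R * 'C(2 * n, n - d)%:R :> R.
  by rewrite -!natrM e.
have -> : c (n - d)%N = (-1) ^+ (n - d) * ((n + d)%:R * 'C(2 * n, n - d)%:R).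
  by rewrite -e /c; ring.
have -> : (-1) ^+ (n - d) = - (-1) ^+ d.-1 :> R.
  rewrite -signr_odd -[in RHS]signr_odd.
  have -> : odd (n - d) = ~~ odd d.-1 by lia.
  by case: odd; rewrite /= ?expr0 ?expr1 ?opprK.
by rewrite !natrM; ring.
Qed.

Lemma rep_harm k : (k < p)%N -> rep (harm rat k) (harm R k).
Proof.
move=> kp; rewrite /harm big_seq_cond [X in rep _ X]big_seq_cond; apply: rep_sum => i.
rewrite andbT mem_index_iota => ip; apply: rep_inv (rep_nat _).
by apply: natr_lt_unit; lia.
Qed.

Lemma alt_bin_sumR :
  \sum_(1 <= d < n.+1)
     (-1) ^+ d.-1 * (2 * (n + d) * 'C(2 * n, n - d))%:R / d%:R =
  C * (1 + (2 * n)%:R * (harm R (2 * n) - harm R n)).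
Proof.
have N0 : (0 < N)%N by apply: N_gt0.
have n0 : (0 < n)%N by lia.
apply: (@rep_uniq (\sum_(1 <= d < n.+1)
     (-1) ^+ d.-1 * (2 * (n + d) * 'C(2 * n, n - d))%:R / d%:R)).
  rewrite big_seq_cond [X in rep _ X]big_seq_cond; apply: rep_sum => d.
  rewrite andbT mem_index_iota => dn; apply: rep_div (rep_nat _).
    by apply: natr_lt_unit; lia.
  apply: repM (rep_nat _); elim: d.-1 => [|k IHk]; first exact: rep1.
  by rewrite !exprS; apply: repM IHk; apply: repN rep1.
rewrite alt_bin_sum //; apply: repM (rep_nat _) _; apply: repD rep1 _.
by apply: repM (rep_nat _) _; apply: repB; apply: rep_harm; lia.
Qed.

(** The main part is p C - C. The correction is - p C, since its harmonic difference runs over the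
    symmetric block 2 N < i <= 4 N and vanishes modulo p. *)
Lemma jac2E : jac2 = - C.
Proof.
have n0 : (0 < N)%N by apply: N_gt0.
have -> : jac2 = \sum_(t : F) tau t ^+ (2 * n) * (1 - tau t) ^+ (2 * n) +
  P * \sum_(t : F) tau t ^+ (2 * n) *
      ((2 * n)%:R * (1 - tau t) ^+ (2 * n).-1 * (- logpoly (tau t))).
  rewrite mulr_sumr -big_split; apply: eq_bigr => t _ /=.
  have nE : (2 * n = (2 * n).-1.+1)%N by lia.
  rewrite tau_1sub_log; have := exp_add_p (1 - tau t) (- logpoly (tau t)) (2 * n).-1.
  by rewrite -nE => ->; ring.
rewrite jac2_main jac2_correction alt_bin_sumR.
have : P * (harm R (2 * n) - harm R n) = 0.
  have -> : harm R (2 * n) - harm R n = range_harm n (2 * n).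
    rewrite -[harm R (2 * n)]/(range_harm 0 (2 * n)) -[harm R n]/(range_harm 0 n).
    by rewrite (@range_harm_cat n 0 (2 * n)); [rewrite addrC addKr|lia].
  have -> : (2 * n = 4 * N)%N by lia.
  exact: range_harm_mid.
set h := _ - _ => Ph.
transitivity (P * C - C - (P * C + C * (2 * n)%:R * (P * h))); first by ring.
by rewrite Ph; ring.
Qed.

Local Notation chi t := (tau t ^+ n).

Definition jac1 : R := \sum_(t : F) chi t * chi (1 - t).

Lemma sum_chi : \sum_(t : F) chi t = 0.
Proof.
have N0 : (0 < N)%N by apply: N_gt0.
rewrite sum_tau; last by lia.
have -> : (p.-1 %| n)%N = false by apply: gtnNdvd; lia.
by rewrite mul0r.
Qed.

Lemma sum_chi2 : \sum_(t : F) tau t ^+ (2 * n) = 0.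
Proof.
have N0 : (0 < N)%N by apply: N_gt0.
rewrite sum_tau; last by lia.
have -> : (p.-1 %| 2 * n)%N = false by apply: gtnNdvd; lia.
by rewrite mul0r.
Qed.

Lemma tau_exp3 t : t != 0 -> tau t ^+ (3 * n) = 1.
Proof.
move=> t0; rewrite -tauX; have -> : (3 * n = p.-1)%N by lia.
by rewrite Fp_exp_pred // tau1.
Qed.

Lemma chi0 : chi 0 = 0.
Proof.
have N0 : (0 < N)%N by apply: N_gt0.
by rewrite tau0 expr0n eqn0Ngt; have -> : (0 < n)%N by lia.
Qed.

Lemma chi2_0 : tau 0 ^+ (2 * n) = 0.
Proof. by rewrite mulnC exprM chi0 expr0n. Qed.

(* b |-> (1 - bc)/(1 - b) is a bijection from F \ {1} to F \ {c}. *)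
Lemma sum_chi_mobius (c : F) : c != 1 ->
  \sum_(b : F | (b != 0) && (b != 1)) chi ((1 - b * c) / (1 - b)) = - chi c - 1.
Proof.
move=> c1; have cn : 1 - c != 0 by rewrite subr_eq0 eq_sym.
have -> : \sum_(b : F | (b != 0) && (b != 1)) chi ((1 - b * c) / (1 - b)) =
    \sum_(b : F | b != 1) chi ((1 - b * c) / (1 - b)) - 1.
  rewrite [in RHS](bigD1 0) 1?eq_sym ?oner_eq0 //=.
  rewrite mul0r !subr0 divr1 tau1 expr1n addrAC subrr add0r.
  by apply: eq_bigl => b; rewrite andbC.
congr (_ - _).
pose h (y : F) := 1 - (1 - c) / (y - c); pose h' (b : F) := (1 - b * c) / (1 - b).
transitivity (\sum_(y : F | y != c) chi y); last first.
  by have := sum_chi; rewrite (bigD1 c) //= => /eqP; rewrite addrC addr_eq0 => /eqP.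
have b1 (b : F) : b != 1 -> 1 - b != 0 by rewrite subr_eq0 eq_sym.
have yc (y : F) : y != c -> y - c != 0 by rewrite subr_eq0.
have h'E b : b != 1 -> h' b - c = (1 - c) / (1 - b).
  by move=> /b1 bn; rewrite /h'; field.
have hE y : y != c -> 1 - h y = (1 - c) / (y - c).
  by move=> yn; rewrite /h opprB addrC subrK.
have hK b : b != 1 -> h (h' b) = b.
  by move=> bn; rewrite /h h'E // invfM invrK mulVKf // opprB addrC subrK.
have h'K y : y != c -> h' (h y) = y.
  move=> yn; have := hE _ yn; move: (yc _ yn) => ycn.
  rewrite /h' => ->; rewrite /h; field.
  by rewrite ycn cn.
rewrite [RHS](reindex_onto h' h) => [|y]; last exact: h'K.
apply: eq_bigl => b; have [->|bn] := eqVneq b 1.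
  (* Division by zero gives [h' 1 = 0]. The index b = 1 must still be excluded: either c = 0, or h 0
     = 1 / c differs from 1. *)
  rewrite /h' subrr invr0 mulr0; apply/esym/negbTE; rewrite negb_and.
  have [c0|c0] := eqVneq c 0; first by [].
  rewrite /= /h sub0r invrN mulrN opprK.
  apply/eqP => e; move/eqP: cn; apply.
  have : (1 - c) / c = 0 by apply: (addrI 1); rewrite e addr0.
  by move/eqP; rewrite mulf_eq0 invr_eq0 (negbTE c0) orbF => /eqP.
rewrite hK // eqxx andbT -subr_eq0 h'E //.
by rewrite mulf_neq0 ?invr_neq0 ?b1.
Qed.

(** Replacing the variable of [jac1] by b c, and using that the character has order 3, leaves a
    double sum over b and c. The part c = 1 is p - 2; by [sum_chi_mobius] the parts c != 1 give -
    chi(c)^2 - chi(c), hence 2 in total. *)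
Lemma jac1_jac2 : jac1 * jac2 = P.
Proof.
have pF : p.-1%:R = P - 1 :> R by rewrite -subn1 natrB ?prime_gt0.
transitivity (\sum_(b : F | (b != 0) && (b != 1)) \sum_(c : F)
    chi c * chi ((1 - b * c) / (1 - b))).
  rewrite mulrC /jac2 mulr_suml [RHS]big_mkcond; apply: eq_bigr => b _ /=.
  have [->|b0] /= := eqVneq b 0; first by rewrite chi2_0 !mul0r.
  have [->|b1] /= := eqVneq b 1; first by rewrite subrr chi2_0 mulr0 mul0r.
  have bI : bijective ( *%R b).
    by exists ( *%R b^-1) => x; rewrite ?mulKf ?mulVKf.
  rewrite /jac1 (reindex ( *%R b)) /=; last exact: onW_bij.
  rewrite mulr_sumr; apply: eq_bigr => c _.
  have bn : 1 - b != 0 by rewrite subr_eq0 eq_sym.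
  have -> : tau (1 - b * c) = tau ((1 - b * c) / (1 - b)) * tau (1 - b).
    by rewrite -tauM divfK.
  rewrite tauM; set x := tau (_ / _); rewrite !exprMn.
  transitivity (tau c ^+ n * x ^+ n * tau b ^+ (3 * n) * tau (1 - b) ^+ (3 * n)).
    have -> : (3 * n = n + n + n)%N by lia.
    have -> : (2 * n = n + n)%N by lia.
    by rewrite !exprD; ring.
  by rewrite !tau_exp3 // !mulr1.
rewrite exchange_big /= (bigD1 1) //=.
rewrite [X in X + _](eq_bigr (fun=> 1)) => [|b /andP[b0 b1]]; last first.
  by rewrite mulr1 divff ?tau1 ?expr1n ?mulr1 // subr_eq0 eq_sym.
rewrite [X in _ + X](eq_bigr (fun c => - (tau c ^+ (2 * n) + chi c))) => [|c c1]; last first.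
  rewrite -mulr_sumr sum_chi_mobius //; have -> : (2 * n = n + n)%N by lia.
  by rewrite exprD; ring.
rewrite sumrN big_split /=.
have s1 : \sum_(c : F | c != 1) chi c = - 1.
  have := sum_chi; rewrite (bigD1 1) //= tau1 expr1n => /eqP.
  by rewrite addrC addr_eq0 => /eqP.
have s2 : \sum_(c : F | c != 1) tau c ^+ (2 * n) = - 1.
  have := sum_chi2; rewrite (bigD1 1) //= tau1 expr1n => /eqP.
  by rewrite addrC addr_eq0 => /eqP.
rewrite s1 s2.
have : \sum_(b : F | b != 0) 1 = P - 1 :> R.
  rewrite -pF sumr_const -[in RHS](card_Fp p_prime) -(cardC1 (0 : F)).
  by congr (_ *+ _); apply: eq_card.
rewrite (bigD1 1) ?oner_eq0 //= => e.
by rewrite -[X in X + _](addKr 1) e; ring.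
Qed.

Definition cubic_class (z : F) : {set F} := [set t | (t * (1 - t)) ^+ n == z].

(* t |-> 1/(1 - t) has order 3 and preserves the cubic class of t(1 - t); its
   fixed points satisfy t(1 - t) = 1. *)
Lemma cubic_class_dvd3 (z : F) : z != 0 -> z != 1 -> (3 %| #|cubic_class z|)%N.
Proof.
have N0 : (0 < N)%N by apply: N_gt0.
have n0 : (0 < n)%N by lia.
move=> z0 z1; apply: (@dvdn3_card _ (fun t => (1 - t)^-1)) => t; rewrite !inE => /eqP tz.
have : t * (1 - t) != 0.
  by apply: contraNneq z0 => e; rewrite -tz e expr0n eqn0Ngt n0.
rewrite mulf_eq0 negb_or => /andP[t0 t1].
have e1 : 1 - (1 - t)^-1 = - t / (1 - t) by field.
split.
- apply/eqP; rewrite e1 -tz mulrA mulrN mulNr exprNn.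
  have -> : (-1) ^+ n = 1 :> F by rewrite exprM sqrrN !expr1n.
  rewrite mul1r; have -> : (1 - t)^-1 * t / (1 - t) = t * (1 - t) / (1 - t) ^+ 3 by field.
  rewrite [LHS]exprMn exprVn -exprM.
  have -> : (3 * n = p.-1)%N by lia.
  by rewrite Fp_exp_pred // invr1 mulr1.
- apply: contraNneq z1 => e; rewrite -tz -{1}e mulVf // expr1n //.
- rewrite e1 invf_div; have -> : 1 - (1 - t) / - t = t^-1 by field; rewrite oppr_eq0 t0.
  by rewrite invrK.
Qed.

Lemma sum_pred_card (T : finType) (Q : pred T) :
  (\sum_(t : T) (Q t : nat) = #|[set t | Q t]|)%N.
Proof.
rewrite -sum1_card [RHS]big_mkcond; apply: eq_bigr => t _ /=.
by rewrite inE; case: (Q t).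
Qed.

Lemma jacobi_norm_trace : exists X Z : int,
  [/\ 4%:Z * p%:Z = X ^+ 2 + 27%:Z * Z ^+ 2, (X = 1 %[mod 3])%Z &
      (X%:~R : R) = jac1 + jac2].
Proof.
have N0 : (0 < N)%N by apply: N_gt0.
have n0 : (0 < n)%N by lia.
have pn : p.-1 = (3 * n)%N by lia.
have [g g0 gn] : exists2 g : F, g != 0 & g ^+ n != 1.
  by apply: exists_nonroot; rewrite gtnNdvd //; lia.
set zt := g ^+ n in gn.
have zt3 : zt ^+ 3 = 1 by rewrite /zt -exprM mulnC -pn Fp_exp_pred.
have zt0 : zt != 0 by rewrite expf_neq0.
have zt21 : zt ^+ 2 != 1.
  by apply: contraNneq gn => e; move: zt3; rewrite exprS e mulr1 => ->.
have zt2 : zt ^+ 2 != zt.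
  by apply: contraNneq gn => e; rewrite -[zt](mulKf zt0) -expr2 e mulVf.
have zt20 : zt ^+ 2 != 0 by rewrite expf_neq0.
set w := tau zt.
have w3 : w ^+ 3 = 1 by rewrite -tauX zt3 tau1.
(* From w^3 = 1 by cancelling w - 1, which is a unit. *)
have ww : w ^+ 2 + w + 1 = 0.
  apply: (mulrI (tau_sub1_unit gn)); rewrite mulr0 -/w.
  transitivity (w ^+ 3 - 1); [by ring|by rewrite w3 subrr].
pose y (t : F) := (t * (1 - t)) ^+ n.
have y3 t : (t != 0) && (t != 1) -> [|| y t == 1, y t == zt | y t == zt ^+ 2].
  move=> /andP[t0 t1].
  have u0 : t * (1 - t) != 0 by rewrite mulf_neq0 // subr_eq0 eq_sym.
  have y3 : y t ^+ 3 = 1 by rewrite /y -exprM mulnC -pn Fp_exp_pred.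
  have zz : zt ^+ 2 + zt + 1 = 0.
    have zn : zt - 1 != 0 by rewrite subr_eq0.
    apply: (mulfI zn); rewrite mulr0.
    transitivity (zt ^+ 3 - 1); [by ring|by rewrite zt3 subrr].
  have : (y t - 1) * ((y t - zt) * (y t - zt ^+ 2)) == 0.
    apply/eqP; transitivity (y t ^+ 3 - zt ^+ 3 - y t ^+ 2 * (zt ^+ 2 + zt + 1) +
      y t * zt * (zt ^+ 2 + zt + 1)); first by ring.
    by rewrite y3 zt3 zz !mulr0 !subrr addr0.
  by rewrite !mulf_eq0 !subr_eq0.
have yt0 t : ~~ ((t != 0) && (t != 1)) -> y t = 0.
  rewrite negb_and !negbK => t01.
  rewrite /y; suff -> : t * (1 - t) = 0 by rewrite expr0n eqn0Ngt n0.
  by case/orP: t01 => /eqP ->; ring.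
have ind t : tau (y t) = (y t == 1)%:R + (y t == zt)%:R * w + (y t == zt ^+ 2)%:R * w ^+ 2 /\
    tau (y t) ^+ 2 = (y t == 1)%:R + (y t == zt)%:R * w ^+ 2 + (y t == zt ^+ 2)%:R * w.
  have [t01|] := boolP ((t != 0) && (t != 1)).
    have /or3P[] := y3 t t01 => /eqP ->.
    - rewrite eqxx ![1 == _]eq_sym (negbTE gn) (negbTE zt21) tau1.
      by split; rewrite /=; ring.
    - rewrite eqxx (negbTE gn) [zt == zt ^+ 2]eq_sym (negbTE zt2) -/w.
      by split; rewrite /=; ring.
    - rewrite eqxx (negbTE zt21) (negbTE zt2) tauX -/w; split; first by rewrite /=; ring.
      by rewrite /= -exprM -[in LHS](_ : 3 + 1 = 2 * 2)%N // exprD w3; ring.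
  move/yt0 => ->; rewrite tau0 [0 == 1]eq_sym oner_eq0 ![0 == _]eq_sym (negbTE zt0) (negbTE zt20).
  by split; rewrite /=; ring.
set A := #|cubic_class 1|; set B := #|cubic_class zt|; set D := #|cubic_class (zt ^+ 2)|.
have Asum z : \sum_(t : F) (y t == z)%:R = #|cubic_class z|%:R :> R by rewrite -natr_sum sum_pred_card.
have j1 : jac1 = A%:R + B%:R * w + D%:R * w ^+ 2.
  rewrite /jac1 -!Asum !mulr_suml -!big_split; apply: eq_bigr => t _ /=.
  by rewrite -exprMn -tauM -tauX; case: (ind t).
have j2 : jac2 = A%:R + B%:R * w ^+ 2 + D%:R * w.
  rewrite /jac2 -!Asum !mulr_suml -!big_split; apply: eq_bigr => t _ /=.
  by rewrite -exprMn -tauM mulnC exprM -tauX; case: (ind t).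
have ABD : (A + B + D)%N = p.-2.
  rewrite /A /B /D -!sum_pred_card -!big_split /=.
  transitivity (\sum_(t : F) (((t != 0) && (t != 1))%R : nat))%N.
    apply: eq_bigr => t _; rewrite -[(t * (1 - t)) ^+ n]/(y t).
    have [t01|] := boolP ((t != 0) && (t != 1)).
      have /or3P[] := y3 t t01 => /eqP ->.
      - by rewrite eqxx ![1 == _]eq_sym (negbTE gn) (negbTE zt21).
      - by rewrite eqxx (negbTE gn) [zt == zt ^+ 2]eq_sym (negbTE zt2).
      - by rewrite eqxx (negbTE zt21) (negbTE zt2).
    by move/yt0 => ->; rewrite [0 == 1]eq_sym oner_eq0 ![0 == _]eq_sym (negbTE zt0) (negbTE zt20).
  rewrite sum_pred_card; apply/eqP; rewrite -(eqn_add2l 2); apply/eqP.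
  have -> : (2 + p.-2 = p)%N by lia.
  rewrite -[RHS](card_Fp p_prime) -cardsT [RHS](cardsD1 (0 : F)).
  rewrite [X in _ = (_ + X)%N](cardsD1 (1 : F)) !inE oner_eq0 addnA /=.
  congr (_ + _)%N; by apply: eq_card => t; rewrite !inE andbT andbC.
have /dvdnP[b Bb] := cubic_class_dvd3 zt0 gn; have /dvdnP[d Dd] := cubic_class_dvd3 zt20 zt21.
rewrite -/B -/D in Bb Dd.
pose Nm : int := A%:Z ^+ 2 + B%:Z ^+ 2 + D%:Z ^+ 2 - A%:Z * B%:Z - B%:Z * D%:Z - A%:Z * D%:Z.
have NmP : (Nm - p%:Z)%:~R = 0 :> R.
  rewrite rmorphB /= -[p%:Z%:~R]/P -jac1_jac2 j1 j2 /Nm !rmorphB !rmorphD !rmorphM /=.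
  rewrite -![_%:Z%:~R]/(_%:R : R).
  set a : R := A%:R; set b' : R := B%:R; set d' : R := D%:R.
  transitivity ((1 - w ^+ 3) * (b' ^+ 2 + d' ^+ 2) - (w ^+ 2 + w + 1) *
    (a * b' + a * d' + b' * d' * (w ^+ 2 - w + 1))); first by ring.
  by rewrite w3 ww subrr !mul0r subr0.
have {NmP} NmE : Nm = p%:Z.
  have [k kE] := intr_eq0_dvd NmP.
  have k0 : k = 0.
    apply: (small_multiple_eq0 (prime_gt1 p_prime) kE).
    by rewrite -ABD; apply: eisenstein_norm_bounds.
  by apply/eqP; rewrite -subr_eq0 kE k0 mulr0.
(* 4 Nm = (2 A - B - D)^2 + 3 (B - D)^2, where B = 3 b and D = 3 d. Modulo 3, A = p - 2 = 2, so X =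
   2 A = 1. *)
exists (2%:Z * A%:Z - B%:Z - D%:Z), (b%:Z - d%:Z); split.
- by rewrite -NmE /Nm Bb Dd; lia.
- by lia.
- rewrite !rmorphB rmorphM /= -![_%:Z%:~R]/(_%:R : R) j1 j2.
  transitivity (2%:R * A%:R - B%:R - D%:R + (B%:R + D%:R) * (w ^+ 2 + w + 1)).
    by rewrite ww mulr0 addr0.
  by ring.
Qed.

Lemma trace_congruence (x y : int) : 4%:Z * p%:Z = x ^+ 2 + 27%:Z * y ^+ 2 ->
  (x = 2 %[mod 3])%Z -> x%:~R = C + P / C.
Proof.
move=> xy x2; have [X [Z [XZ X1 Xj]]] := jacobi_norm_trace.
have -> : x = - X.
  exact: (norm27_unique p_prime p_gt3 xy XZ).
have Cu := central_bin_unit pN.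
have j1 : jac1 = - (P / C).
  by apply: (mulIr Cu); rewrite mulNr mulrVK // -jac1_jac2 jac2E; ring.
by rewrite rmorphN /= Xj jac2E j1 opprD !opprK addrC.
Qed.

End JacobiSum.

(** * From the sums at s = 0 to the two congruences *)

Lemma rep_hterm0 k : (k < p)%N -> rep (hterm 0 k) (htermR 0 k).
Proof. exact: (@rep_hterm 0). Qed.

Lemma rep_hsum0 : rep (\sum_(0 <= k < p) hterm 0 k) (hsumR 0).
Proof.
rewrite /hsumR big_seq_cond [X in rep _ X]big_seq_cond; apply: rep_sum => k.
by rewrite andbT mem_index_iota => /andP[_]; apply: rep_hterm0.
Qed.

Lemma rep_hwsum0 : rep (\sum_(0 <= k < p) (k%:R + 1) * hterm 0 k) (hwsumR 0).
Proof.
rewrite /hwsumR big_seq_cond [X in rep _ X]big_seq_cond; apply: rep_sum => k.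
rewrite andbT mem_index_iota => /andP[_ kp]; apply: repM; last exact: rep_hterm0.
by rewrite addr0; apply: repD rep1; apply: rep_nat.
Qed.

Lemma first_congruence (n : nat) :
  P * (hsumR 0 - hwsumR 0) = P * 'C(2 * n, n)%:R ->
  eqmod_Zloc p 1
     (\sum_(0 <= k < p)
        ('C(2 * k, k)%:R * 'C(3 * k, k)%:R) / (k.+1%:R * 24%:R ^+ k))
     (1 / 2%:R * 'C(2 * n, n)%:R).
Proof.
move=> h; have u24 : (24%:R : R) \is a GRing.unit.
  by rewrite -[24%N]/(2 * 12)%N natrM unitrM unit2 unit12.
have -> : \sum_(0 <= k < p)
    ('C(2 * k, k)%:R * 'C(3 * k, k)%:R) / (k.+1%:R * 24%:R ^+ k) =
  p%:R * (4%:R * hterm 0 p) + 1 / 2%:R *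
  (\sum_(0 <= k < p) hterm 0 k - \sum_(0 <= k < p) (k%:R + 1) * hterm 0 k).
  have e := hterm0_sum_telescope p.
  have -> : p%:R * (4%:R * hterm 0 p) = 1 / 2%:R * (8%:R * p%:R * hterm 0 p).
    by field.
  rewrite -e -mulrDr -sumrB -big_split mulr_sumr /=; apply: eq_bigr => k _.
  have k1 : k%:R + 1 != 0 :> rat by rewrite natr1 pnatr_eq0.
  rewrite -natrM hterm_binomial -!natr1.
  have e24 : 24%:R ^+ k != 0 :> rat by rewrite expf_neq0.
  by field; rewrite k1 e24.
have r1 : rep (1 / 2%:R) (1 / 2%:R).
  by apply: rep_div rep1 (rep_nat _); exact: unit2.
(* The telescoped boundary term has index p, beyond the range of [rep_hterm]; its binomial form
   shows that it is p-integral. *)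
have rp : rep (hterm 0 p) (('C(2 * p, p) * 'C(3 * p, p))%:R / 24%:R ^+ p).
  rewrite hterm_binomial; apply: rep_div (rep_nat _) _; first exact: unitrX.
  by rewrite -!natrX; apply: rep_nat.
apply: (rep_eqmod1
  (repD (repM (rep_nat p) (repM (rep_nat 4) rp)) (repM r1 (repB rep_hsum0 rep_hwsum0)))
  (repM r1 (rep_nat 'C(2 * n, n)))).
rewrite mulrDr mulrA p_sqr0 mul0r add0r mulrCA h mulrCA //.
Qed.

Lemma second_congruence (x : int) : hsumR 0 + hwsumR 0 = x%:~R ->
  eqmod_Zloc p 2
     (\sum_(0 <= k < p)
        (k + 2)%:R / 24%:R ^+ k * 'C(2 * k, k)%:R * 'C(3 * k, k)%:R) x%:~R.
Proof.
move=> h; have -> : \sum_(0 <= k < p)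
    (k + 2)%:R / 24%:R ^+ k * 'C(2 * k, k)%:R * 'C(3 * k, k)%:R =
  \sum_(0 <= k < p) hterm 0 k + \sum_(0 <= k < p) (k%:R + 1) * hterm 0 k.
  rewrite -big_split /=; apply: eq_bigr => k _.
  by rewrite hterm_binomial natrM natrD; ring.
by apply: rep_eqmod2 (repD rep_hsum0 rep_hwsum0) _; rewrite h; apply: rep_int.
Qed.

Lemma p_6N1 : (p %% 3 = 1)%N -> p = (6 * (p %/ 6) + 1)%N.
Proof.
have [p2|po] := even_prime p_prime; first by move: p_gt3; rewrite p2.
by move=> p3; move: po; lia.
Qed.

Lemma p_mul_sums_1mod3 N : p = (6 * N + 1)%N ->
  P * (hsumR 0 - hwsumR 0) = P * 'C(2 * (2 * N), 2 * N)%:R.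
Proof.
move=> pN; rewrite mulrBr (hsumR0_1mod3 pN).
suff -> : P * hwsumR 0 = 0 by rewrite subr0.
apply: (mulIr (central_bin_unit pN)).
by rewrite -mulrA (hwsumR0_1mod3 pN) p_sqr0 mul0r.
Qed.

Lemma p_mul_sums_2mod3 m : p = (3 * m + 2)%N ->
  P * (hsumR 0 - hwsumR 0) = P * 'C(2 * m.+1, m.+1)%:R.
Proof.
by move=> pm; rewrite mulrBr (p_mul_hsumR0_2mod3 pm) (p_mul_hwsumR0_2mod3 pm) sub0r opprK.
Qed.

Lemma sums_trace N (x y : int) : p = (6 * N + 1)%N ->
  4%:Z * p%:Z = x ^+ 2 + 27%:Z * y ^+ 2 -> (x = 2 %[mod 3])%Z ->
  hsumR 0 + hwsumR 0 = x%:~R.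
Proof.
move=> pN xy x2; rewrite (trace_congruence pN xy x2) (hsumR0_1mod3 pN).
congr (_ + _); apply: (mulIr (central_bin_unit pN)).
by rewrite (hwsumR0_1mod3 pN) divrK // central_bin_unit.
Qed.

End ModSquare.

Theorem corollary2 (p : nat) (p_prime : prime p) (p_gt3 : (3 < p)%N) :
  (let n := `|((p%:Z - legendre3 p) %/ 3)%Z|%N in
   eqmod_Zloc p 1
     (\sum_(0 <= k < p)
        ('C(2 * k, k)%:R * 'C(3 * k, k)%:R) / (k.+1%:R * 24%:R ^+ k))
     (1 / 2%:R * 'C(2 * n, n)%:R))
  /\
  ((p = 1 %[mod 3])%N ->
   forall x y : int,
     4%:Z * p%:Z = x ^+ 2 + 27%:Z * y ^+ 2 ->
     (x = 2 %[mod 3])%Z ->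
     eqmod_Zloc p 2
       (\sum_(0 <= k < p)
          (k + 2)%:R / 24%:R ^+ k * 'C(2 * k, k)%:R * 'C(3 * k, k)%:R)
       x%:~R).
Proof.
(* R is instantiated with ['Z_(p ^ 2)], which is Z/p^2 because p^2 > 1. *)
have q1 : (1 < p ^ 2)%N by rewrite -(exp1n 2) ltn_exp2r // prime_gt1.
have unitZ a : coprime p a -> (a%:R : 'Z_(p ^ 2)) \is a GRing.unit.
  by move=> pa; rewrite unitZpE // coprime_pexpl.
have eq0Z a : (a%:R == 0 :> 'Z_(p ^ 2)) = (p ^ 2 %| a)%N.
  by rewrite -val_eqE /= val_Zp_nat.
have p3 : ~~ (3 %| p)%N by apply: p_mod3.
split=> [n|p1 x y xy x2].
  have [p1|p2] : (p %% 3 = 1 \/ p %% 3 = 2)%N by move: p3; lia.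
    apply: (first_congruence p_prime p_gt3 unitZ eq0Z).
    have pN := p_6N1 p_prime p_gt3 p1.
    have -> : n = (2 * (p %/ 6))%N by rewrite /n /legendre3 p1 /=; lia.
    exact: p_mul_sums_1mod3.
  apply: (first_congruence p_prime p_gt3 unitZ eq0Z).
  have pm : p = (3 * (p %/ 3) + 2)%N by lia.
  have -> : n = (p %/ 3).+1 by rewrite /n /legendre3 p2 /=; lia.
  exact: p_mul_sums_2mod3.
apply: (second_congruence p_prime p_gt3 unitZ eq0Z).
exact: sums_trace (p_6N1 p_prime p_gt3 p1) xy x2.
Qed.
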